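(* Let $\Lambda_0\subset\mathbb{R}^d$ be an aperiodic and repetitive Delone set of finite local complexity with pattern space $\Omega$, and assume that the action of $\mathbb{R}^d$ on $\Omega$ by translations is uniquely ergodic with unique invariant probability measure $\mu$. Let $f:\Omega\to\mathbb{R}$ be a harmonic function (i.e. harmonic in $\Omega$). If either $d=1$, or $\inf f>-\infty$, or $\sup f<\infty$, or $f\in L^1(\Omega,\mu)$, then $f$ is $\mu$-a.e. constant.
   Context: Delone sets. $\Lambda\subset\mathbb{R}^d$ is a Delone set if it is uniformly discrete (there is $\varepsilon>0$ with $|\vec x-\vec y|>\varepsilon$ for all distinct $\vec x,\vec y\in\Lambda$) and relatively dense (there is $R>0$ with $\Lambda\cap B_R(\vec x)\ne\varnothing$ for all $\vec x\in\mathbb{R}^d$). A cluster is a finite subset of $\Lambda$. $\Lambda$ has finite local complexity if for every $R>0$ there are finitely many clusters $P_1,\dots,P_n$ such that for each $\vec x\in\mathbb{R}^d$ the set $B_R(\vec x)\cap\Lambda$ is a translate of some $P_i$. It is aperiodic if $\Lambda-\vec t=\Lambda$ implies $\vec t=\vec 0$. It is repetitive if for every cluster $P\subset\Lambda$ there is $R_P>0$ such that for every $\vec x\in\mathbb{R}^d$ the set $B_{R_P}(\vec x)\cap\Lambda$ contains a translate of $P$. Pattern space. Write $\varphi_{\vec t}(\Lambda)=\Lambda-\vec t$. Put $\varrho(\Lambda_1,\Lambda_2)=\min\{\bar\varrho(\Lambda_1,\Lambda_2),2^{-1/2}\}$, where $\bar\varrho(\Lambda_1,\Lambda_2)$ is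 the infimum of all $\varepsilon>0$ such that there exist $\vec s,\vec t\in B_\varepsilon(\vec 0)$ with $B_{1/\varepsilon}(\vec 0)\cap\varphi_{\vec s}(\Lambda_1)=B_{1/\varepsilon}(\vec 0)\cap\varphi_{\vec t}(\Lambda_2)$. The pattern space $\Omega$ of $\Lambda_0$ is the closure of $\{\varphi_{\vec t}(\Lambda_0):\vec t\in\mathbb{R}^d\}$ with respect to the metric $\varrho$; it is a compact metric space of Delone sets on which $\mathbb{R}^d$ acts continuously by $\varphi$. Unique ergodicity means there is exactly one Borel probability measure $\mu$ on $\Omega$ invariant under all $\varphi_{\vec t}$. Harmonic functions. For $f:\Omega\to\mathbb{R}$ and $\Lambda\in\Omega$ let $h_\Lambda^*f(\vec t)=f(\varphi_{\vec t}(\Lambda))$, $\vec t\in\mathbb{R}^d$. A Borel measurable $f:\Omega\to\mathbb{R}$ is harmonic in an open set $O\subset\Omega$ if for each $\Lambda\in O$ the function $\vec t\mapsto h_\Lambda^*f(\vec t)$ is harmonic in the usual Euclidean sense ($C^2$ with vanishing Laplacian) on an open neighborhood of $\vec 0$ in $\mathbb{R}^d$. *)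

(* Defs.v *)
From HB Require Import structures.
From mathcomp Require Import all_boot all_order all_algebra.
From mathcomp Require Import all_classical all_reals all_analysis.
From mathcomp Require Import ring lra.

Set Implicit Arguments.
Unset Strict Implicit.
Unset Printing Implicit Defensive.

Import Order.TTheory GRing.Theory Num.Theory.
Import numFieldNormedType.Exports.

Local Open Scope classical_set_scope.
Local Open Scope ring_scope.

(* The library norm on 'rV[R]_d is the sup norm; it induces the same topology
   and the same derivatives, but the balls below must be Euclidean. *)
Section euclidean.
Context {R : realType} {d : nat}.
Implicit Types (x y z : 'rV[R]_d) (r : R).

Definition enorm x : R := Num.sqrt (\sum_i x ord0 i ^+ 2).

(* Open balls; closed ones would give the same notions and the same rho below,
   since the radii are always quantified. *)
Definition eball x r : set 'rV[R]_d := [set y | enorm (y - x) < r].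

Lemma enorm_ge0 x : 0 <= enorm x.
Proof. exact: sqrtr_ge0. Qed.

Lemma sumsq_ge0 x : 0 <= \sum_i x ord0 i ^+ 2.
Proof. by apply: sumr_ge0 => i _; exact: sqr_ge0. Qed.

Lemma sqr_enorm x : enorm x ^+ 2 = \sum_i x ord0 i ^+ 2.
Proof. by rewrite sqr_sqrtr// sumsq_ge0. Qed.

Lemma enorm0 : enorm 0 = 0.
Proof. by rewrite /enorm big1 ?sqrtr0// => i _; rewrite mxE expr0n. Qed.

Lemma enormN x : enorm (- x) = enorm x.
Proof. by congr Num.sqrt; apply: eq_bigr => i _; rewrite mxE sqrrN. Qed.

Lemma enormB x y : enorm (x - y) = enorm (y - x).
Proof. by rewrite -enormN opprB. Qed.

Lemma enorm0_eq0 x : enorm x = 0 -> x = 0.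
Proof.
move=> x0; have := sqr_enorm x; rewrite x0 expr0n/= => /esym/eqP.
rewrite psumr_eq0 => [/allP h|i _]; last exact: sqr_ge0.
apply/rowP => i; rewrite mxE; apply/eqP.
by have := h i (mem_index_enum _); rewrite sqrf_eq0.
Qed.

Lemma cauchy_schwarz x y :
  \sum_i x ord0 i * y ord0 i <= enorm x * enorm y.
Proof.
pose A := \sum_i x ord0 i ^+ 2; pose B := \sum_i y ord0 i ^+ 2.
pose C := \sum_i x ord0 i * y ord0 i; rewrite -/C.
have A0 : 0 <= A by exact: sumsq_ge0.
have B0 : 0 <= B by exact: sumsq_ge0.
have [yE|yN0] := eqVneq (enorm y) 0.
  rewrite yE mulr0 /C big1// => i _.
  by rewrite (enorm0_eq0 yE) mxE mulr0.
have Bp : 0 < B.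
  by rewrite /B -sqr_enorm exprn_gt0// lt_neqAle eq_sym yN0 enorm_ge0.
have : 0 <= \sum_i (B * x ord0 i - C * y ord0 i) ^+ 2.
  by apply: sumr_ge0 => i _; exact: sqr_ge0.
have -> : \sum_i (B * x ord0 i - C * y ord0 i) ^+ 2 = B * (A * B - C ^+ 2).
  transitivity (\sum_i (B ^+ 2 * x ord0 i ^+ 2 -
      2 * B * C * (x ord0 i * y ord0 i) + C ^+ 2 * y ord0 i ^+ 2)).
    by apply: eq_bigr => i _; ring.
  by rewrite big_split sumrB -!mulr_sumr -/A -/B -/C /=; ring.
rewrite pmulr_rge0// subr_ge0 => CAB.
have [C0|/ltW C0] := leP C 0.
  by rewrite (le_trans C0)// mulr_ge0// enorm_ge0.
rewrite -(ler_pXn2r (n := 2))// ?nnegrE// ?mulr_ge0 ?enorm_ge0//.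
by rewrite exprMn !sqr_enorm.
Qed.

Lemma enormD x y : enorm (x + y) <= enorm x + enorm y.
Proof.
rewrite -(ler_pXn2r (n := 2))// ?nnegrE ?addr_ge0 ?enorm_ge0//.
rewrite sqr_enorm sqrrD !sqr_enorm.
have -> : \sum_i (x + y) ord0 i ^+ 2 = \sum_i x ord0 i ^+ 2 +
    (\sum_i x ord0 i * y ord0 i) *+ 2 + \sum_i y ord0 i ^+ 2.
  rewrite -sumrMnl -!big_split/=; apply: eq_bigr => i _.
  by rewrite mxE sqrrD.
by rewrite lerD2r lerD2l ler_pMn2r// cauchy_schwarz.
Qed.

End euclidean.

Section delone.
Context {R : realType} {d : nat}.
Implicit Types (L P : set 'rV[R]_d) (s t : 'rV[R]_d).

Definition uniformly_discrete L :=
  exists2 e : R, 0 < e & forall x y, L x -> L y -> x != y -> e < enorm (x - y).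

Definition relatively_dense L :=
  exists2 r : R, 0 < r & forall x, (L `&` eball x r) !=set0.

Definition delone L := uniformly_discrete L /\ relatively_dense L.

(* $\varphi_t(\Lambda) = \Lambda - t$ *)
Definition translate t L : set 'rV[R]_d := [set x - t | x in L].

Definition is_translate_of P L := exists t, L = translate t P.

Definition cluster_of L P := finite_set P /\ P `<=` L.

Definition finite_local_complexity L := forall r : R, 0 < r ->
  exists F : set (set 'rV[R]_d), [/\ finite_set F, F `<=` cluster_of L &
    forall x, exists2 P, F P & is_translate_of P (eball x r `&` L)].

Definition aperiodic L := forall t, translate t L = L -> t = 0.

Definition repetitive L := forall P, cluster_of L P ->
  exists2 r : R, 0 < r & forall x, exists2 P', is_translate_of P P' &
    P' `<=` eball x r `&` L.

Definition agree (e : R) L1 L2 := exists s t,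
  [/\ eball 0 e s, eball 0 e t &
    eball 0 e^-1 `&` translate s L1 = eball 0 e^-1 `&` translate t L2].

(* Taken in \bar R, so that an infimum over the empty set would be +oo. *)
Definition rho_bar L1 L2 : \bar R :=
  ereal_inf [set e%:E | e in [set e : R | 0 < e /\ agree e L1 L2]].

Definition rho L1 L2 : R :=
  fine (mine (rho_bar L1 L2) ((Num.sqrt 2)^-1)%:E).

Lemma translateE t L x : translate t L x <-> L (x + t).
Proof.
split=> [[y Ly <-]|Lxt]; first by rewrite subrK.
by exists (x + t) => //; rewrite addrK.
Qed.

Lemma agreeP e L1 L2 : agree e L1 L2 <-> exists s t,
  [/\ enorm s < e, enorm t < e &
    forall x, enorm x < e^-1 -> (L1 (x + s) <-> L2 (x + t))].
Proof.
split=> -[s [t [se te st]]]; exists s, t; rewrite /eball/= ?subr0 in se te st *.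
  split=> // x xe; split=> Lx.
    have : (eball 0 e^-1 `&` translate s L1) x.
      by split; [rewrite /eball/= subr0|exact/translateE].
    by rewrite st => -[_ /translateE].
  have : (eball 0 e^-1 `&` translate t L2) x.
    by split; [rewrite /eball/= subr0|exact/translateE].
  by rewrite -st => -[_ /translateE].
split=> //; apply/seteqP; split=> x /=; rewrite /eball/= subr0.
  by move=> [xe /translateE Lx]; split=> //; apply/translateE/(st _ xe).
by move=> [xe /translateE Lx]; split=> //; apply/translateE/(st _ xe).
Qed.

Let k : R := (Num.sqrt 2)^-1.

Let k_gt0 : 0 < k.
Proof. by rewrite invr_gt0 sqrtr_gt0. Qed.

Let k_lt1 : k < 1.
Proof. by rewrite invf_lt1 ?sqrtr_gt0// -[ltLHS]sqrtr1 ltr_sqrt// ltr1n. Qed.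

Lemma rho_bar_ge0 L1 L2 : (0 <= rho_bar L1 L2)%E.
Proof. by apply: le_ereal_inf_tmp => _ [e [e0 _] <-]; rewrite lee_fin ltW. Qed.

Lemma rhoE L1 L2 : (rho L1 L2)%:E = mine (rho_bar L1 L2) k%:E.
Proof.
rewrite /rho fineK// ge0_fin_numE.
  by rewrite gt_min ltry orbT.
by rewrite le_min rho_bar_ge0 lee_fin ltW.
Qed.

Lemma rho_ge0 L1 L2 : 0 <= rho L1 L2.
Proof. by rewrite -lee_fin rhoE le_min rho_bar_ge0 lee_fin ltW. Qed.

Lemma rho_le L1 L2 : rho L1 L2 <= (Num.sqrt 2)^-1.
Proof. by rewrite -lee_fin rhoE ge_min lexx orbT. Qed.

Lemma agree_rho e L1 L2 : 0 < e -> agree e L1 L2 -> rho L1 L2 <= e.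
Proof.
move=> e0 ae; rewrite -lee_fin rhoE ge_min; apply/orP; left.
by apply: ereal_inf_lbound; exists e.
Qed.

Lemma rho_agree c L1 L2 : rho L1 L2 < c -> c <= (Num.sqrt 2)^-1 ->
  exists e, [/\ 0 < e, e < c & agree e L1 L2].
Proof.
rewrite -lte_fin rhoE gt_min => /orP[|]; last by rewrite lte_fin ltNge => /negbTE ->.
move=> /ereal_inf_lt[_ [e [e0 ae] <-]]; rewrite lte_fin => ec _.
by exists e.
Qed.

Lemma agree_refl e L : 0 < e -> agree e L L.
Proof.
by move=> e0; apply/agreeP; exists 0, 0; rewrite enorm0.
Qed.

Lemma agree_sym e L1 L2 : agree e L1 L2 -> agree e L2 L1.
Proof.
by move=> [s [t [se te st]]]; exists t, s; split.
Qed.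

Lemma agree_trans a b L1 L2 L3 : 0 < a -> 0 < b -> a + b < 1 ->
  agree a L1 L2 -> agree b L2 L3 -> agree (a + b) L1 L3.
Proof.
move=> a0 b0 ab1 /agreeP[s [t [sa ta st]]] /agreeP[s' [t' [sb tb st']]].
have inv_le (u v : R) : 0 < u -> 0 < v -> u + v < 1 ->
    (u + v)^-1 + v <= u^-1.
  move=> u0 v0 uv1; have uv0 : 0 < u + v by exact: addr_gt0.
  rewrite -subr_ge0.
  have -> : u^-1 - ((u + v)^-1 + v) = v * (1 - u * (u + v)) / (u * (u + v)).
    by field; rewrite !gt_eqF.
  rewrite divr_ge0 ?mulr_ge0 ?(ltW uv0) ?(ltW u0) ?(ltW v0)//.
  by rewrite subr_ge0; nra.
apply/agreeP; exists (s + s'), (t + t'); split.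
- by rewrite (le_lt_trans (enormD _ _))// ltrD.
- by rewrite (le_lt_trans (enormD _ _))// ltrD.
- move=> x xab.
  have xa : enorm (x + s') < a^-1.
    rewrite (le_lt_trans (enormD _ _))//.
    by rewrite (lt_le_trans _ (inv_le a b a0 b0 ab1))// ltrD.
  have xb : enorm (x + t) < b^-1.
    rewrite (le_lt_trans (enormD _ _))//.
    rewrite addrC in ab1; rewrite (lt_le_trans _ (inv_le b a b0 a0 ab1))//.
    by rewrite ltrD// addrC.
  have := st _ xa; have := st' _ xb.
  by rewrite (addrAC x s' t) -!addrA (addrC s' s) => h1 h2; rewrite h2.
Qed.

Lemma rhoxx L : rho L L = 0.
Proof.
apply/eqP; rewrite eq_le rho_ge0 andbT; apply/ler_addgt0Pl => e e0.
by rewrite addr0 agree_rho//; exact: agree_refl.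
Qed.

Lemma rho_sym L1 L2 : rho L1 L2 = rho L2 L1.
Proof.
rewrite /rho /rho_bar; congr (fine (mine (ereal_inf _) _)).
by apply/seteqP; split=> _ [e [e0 /agree_sym ae] <-]; exists e.
Qed.

Lemma rho_triangle L2 L1 L3 : rho L1 L3 <= rho L1 L2 + rho L2 L3.
Proof.
rewrite leNgt; apply/negP => h.
pose r12 := rho L1 L2; pose r23 := rho L2 L3; pose r13 := rho L1 L3.
rewrite -/r12 -/r23 -/r13 in h.
have r12_ge0 : 0 <= r12 by exact: rho_ge0.
have r23_ge0 : 0 <= r23 by exact: rho_ge0.
have r13k : r13 <= k by exact: rho_le.
pose n := (r13 - r12 - r23) / 2.
have n0 : 0 < n by rewrite /n; lra.
have [||a [a0 ar a12]] := @rho_agree (r12 + n) L1 L2.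
- by rewrite -/r12; lra.
- by rewrite -/k /n; lra.
have [||b [b0 br b23]] := @rho_agree (r23 + n) L2 L3.
- by rewrite -/r23; lra.
- by rewrite -/k /n; lra.
have ab13 : a + b < r13.
  have -> : r13 = (r12 + n) + (r23 + n) by rewrite /n; field.
  exact: ltrD.
have ab1 : a + b < 1 by move: k_lt1; lra.
have := agree_rho (addr_gt0 a0 b0) (agree_trans a0 b0 ab1 a12 b23).
by rewrite -/r13 leNgt ab13.
Qed.

Lemma rho0_sub L1 L2 : uniformly_discrete L2 -> rho L1 L2 = 0 -> L1 `<=` L2.
Proof.
move=> [del del0 sep] r0 x Lx.
have close (c : R) : 0 < c -> exists2 y, L2 y & enorm (y - x) < c.
  move=> c0.
  pose c' := Num.min (Num.min (c / 2) k) (enorm x + 1)^-1.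
  have x1 : 0 < enorm x + 1 by rewrite ltr_wpDl// enorm_ge0.
  have c'0 : 0 < c' by rewrite !lt_min k_gt0 divr_gt0//= invr_gt0.
  have [||e [e0 ec /agreeP[s [t [se te st]]]]] := @rho_agree c' L1 L2.
  - by rewrite r0.
  - by rewrite -/k /c' !ge_min lexx orbT.
  move: ec; rewrite !lt_min => /andP[/andP[ec ek] ex].
  have xs : enorm (x - s) < e^-1.
    rewrite (le_lt_trans (enormD _ _))// enormN.
    apply: (@lt_trans _ _ (enorm x + 1)).
      by rewrite ltrD2l (lt_trans se)// (lt_trans ek).
    by rewrite -(invrK (enorm x + 1)) ltf_pV2 ?posrE// invr_gt0.
  exists (x - s + t); first by apply/(st _ xs); rewrite subrK.
  have -> : x - s + t - x = t - s by rewrite addrAC [x - s]addrC addrK addrC.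
  by rewrite (le_lt_trans (enormD _ _))// enormN; lra.
have [y1 L1y y1x] := close (del / 2) (divr_gt0 del0 (ltr0n _ 2)).
have [<-//|y1N] := eqVneq y1 x.
have n0 : 0 < enorm (y1 - x).
  rewrite lt_neqAle enorm_ge0 andbT eq_sym; apply/eqP => /enorm0_eq0/eqP.
  by rewrite subr_eq0 (negbTE y1N).
have [y2 L2y y2x] := close _ n0.
have y12 : y1 != y2 by apply/eqP => E; rewrite E ltxx in y2x.
have := sep _ _ L1y L2y y12.
have -> : y1 - y2 = (y1 - x) - (y2 - x) by rewrite opprB addrA subrK.
move=> h; have := lt_le_trans h (enormD _ _); rewrite enormN.
by move: y1x y2x; lra.
Qed.

Lemma delone_translate t L : delone L -> delone (translate t L).
Proof.
move=> [[e e0 sep] [r r0 dense]]; split.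
- exists e => // x y /translateE Lx /translateE Ly xy.
  have := sep _ _ Lx Ly; rewrite (inj_eq (addIr t)) => /(_ xy).
  by rewrite opprD addrACA subrr addr0.
- exists r => // x; have [y [Ly xy]] := dense (x + t).
  exists (y - t); split; first by apply/translateE; rewrite subrK.
  by move: xy; rewrite /eball/= opprD addrA addrAC.
Qed.

Lemma agree_translate u c : 0 < c -> exists2 e, 0 < e &
  forall L1 L2 a, 0 < a -> a < e -> agree a L1 L2 ->
    agree c (translate u L1) (translate u L2).
Proof.
move=> c0; pose m := c^-1 + enorm u.
have m0 : 0 < m by rewrite ltr_pwDl ?invr_gt0// enorm_ge0.
exists (Num.min c m^-1); first by rewrite lt_min c0 invr_gt0.
move=> L1 L2 a a0; rewrite lt_min => /andP[ac am] /agreeP[s [t [sa ta st]]].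
apply/agreeP; exists s, t; split; [exact: lt_trans ac|exact: lt_trans ac|].
move=> x xc; have xa : enorm (x + u) < a^-1.
  rewrite (le_lt_trans (enormD _ _))// (@lt_trans _ _ m)//.
    by rewrite /m ltrD2r.
  by rewrite -(invrK m) ltf_pV2 ?posrE// invr_gt0.
by rewrite !translateE ![x + _ + u]addrAC; exact: st.
Qed.

Record delone_set := DeloneSet {
  points :> set 'rV[R]_d ;
  deloneP : delone points }.

HB.instance Definition _ := gen_eqMixin delone_set.
HB.instance Definition _ := gen_choiceMixin delone_set.

Lemma delone_set_inj (L1 L2 : delone_set) :
  points L1 = points L2 -> L1 = L2.
Proof.
case: L1 L2 => [L1 D1] [L2 D2] /= E; case: _ / E in D2 *.
by congr DeloneSet; exact: Prop_irrelevance.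
Qed.

Lemma rho0_eq (L1 L2 : delone_set) : rho L1 L2 = 0 -> L1 = L2.
Proof.
move=> r0; apply: delone_set_inj; apply/seteqP; split.
  by apply: rho0_sub => //; case: (deloneP L2).
by apply: rho0_sub; [case: (deloneP L1)|rewrite rho_sym].
Qed.

Let mdist_xx (L : delone_set) : rho L L = 0. Proof. exact: rhoxx. Qed.

Let mdist_C (L1 L2 : delone_set) : rho L1 L2 = rho L2 L1.
Proof. exact: rho_sym. Qed.

Let mdist_tri (L2 L1 L3 : delone_set) : rho L1 L3 <= rho L1 L2 + rho L2 L3.
Proof. exact: rho_triangle. Qed.

HB.instance Definition _ := @isMetric.Build R delone_set
  (fun L1 L2 : delone_set => rho L1 L2) mdist_xx rho0_eq mdist_C mdist_tri.

Definition phi t (L : delone_set) : delone_set :=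
  DeloneSet (delone_translate t (deloneP L)).

Lemma phi_continuous t : continuous (phi t).
Proof.
move=> L; apply/(cvg_ballP (FF := nbhs_filter L)) => c c0.
pose c' := c / 2.
have c'0 : 0 < c' by rewrite divr_gt0.
have c'c : c' < c by rewrite /c'; lra.
apply/nbhs_ballP.
have [e e0 he] := agree_translate t c'0.
exists (Num.min e k); first by rewrite /= lt_min e0.
move=> L'; rewrite !ballEmdist /= => LL'.
have [|a [a0 ae aLL']] := rho_agree LL'; first by rewrite ge_min lexx orbT.
have := he L L' a a0; rewrite (lt_le_trans ae) ?ge_min ?lexx// => /(_ isT aLL').
by move=> /(agree_rho c'0) h; rewrite (le_lt_trans h).
Qed.

End delone.

Arguments delone_set : clear implicits.

Section pattern_space.
Context {R : realType} {d : nat}.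
Variable L0 : delone_set R d.

Definition pattern_set : set (delone_set R d) :=
  closure (range (fun t => phi t L0)).

Lemma pattern_set_phi t L : pattern_set L -> pattern_set (phi t L).
Proof.
move=> OL U nU; have [_ [[u _ <-] Uu]] := OL _ (phi_continuous nU).
exists (phi t (phi u L0)); split=> //; exists (u + t) => //.
apply: delone_set_inj; apply/seteqP; split=> x /=.
  by move=> /translateE; rewrite (addrC u) addrA => h; do 2 apply/translateE.
by move=> /translateE/translateE h; apply/translateE; rewrite (addrC u) addrA.
Qed.

Lemma pattern_set_L0 : pattern_set L0.
Proof.
apply: subset_closure; exists 0 => //; apply: delone_set_inj.
by apply/seteqP; split=> x /=; [move=> /translateE|move=> ?; apply/translateE];
  rewrite addr0.
Qed.

Definition pattern_space : Type := set_type pattern_set.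

HB.instance Definition _ := PseudoMetric.on pattern_space.
HB.instance Definition _ :=
  isPointed.Build pattern_space (exist _ L0 (mem_set pattern_set_L0)).
HB.instance Definition _ := Measurable.copy pattern_space
  (g_sigma_algebraType (@open pattern_space)).

Definition act (t : 'rV[R]_d) (L : pattern_space) : pattern_space :=
  exist _ (phi t (val L)) (mem_set (pattern_set_phi (t := t) (set_mem (valP L)))).

Definition invariant (mu : set pattern_space -> \bar R) :=
  forall t A, measurable A -> mu (act t @^-1` A) = mu A.

Definition uniquely_ergodic (mu : probability pattern_space R) :=
  invariant mu /\
  forall nu : probability pattern_space R, invariant nu ->
    forall A, measurable A -> nu A = mu A.

End pattern_space.

Section harmonic.
Context {R : realType} {d : nat}.

Definition unit_vec (i : 'I_d) : 'rV[R]_d := delta_mx ord0 i.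

Definition C2_on (U : set 'rV[R]_d) (g : 'rV[R]_d -> R) :=
  forall x, U x -> {for x, continuous g} /\
  forall i, [/\ derivable g x (unit_vec i),
    {for x, continuous ('D_(unit_vec i) g)} &
    forall j, derivable ('D_(unit_vec i) g) x (unit_vec j) /\
      {for x, continuous ('D_(unit_vec j) ('D_(unit_vec i) g))}].

Definition laplacian (g : 'rV[R]_d -> R) (x : 'rV[R]_d) : R :=
  \sum_(i < d) 'D_(unit_vec i) ('D_(unit_vec i) g) x.

Definition euclidean_harmonic_on (U : set 'rV[R]_d) (g : 'rV[R]_d -> R) :=
  C2_on U g /\ forall x, U x -> laplacian g x = 0.

(* $h_\Lambda^* f$ *)
Definition pullback (L0 : delone_set R d) (f : pattern_space L0 -> R)
  (L : pattern_space L0) : 'rV[R]_d -> R := fun t => f (act t L).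

Definition harmonic_in (L0 : delone_set R d) (O : set (pattern_space L0))
    (f : pattern_space L0 -> R) :=
  measurable_fun [set: pattern_space L0] f /\
  forall L, O L -> exists U : set 'rV[R]_d,
    [/\ open U, U 0 & euclidean_harmonic_on U (pullback f L)].

End harmonic.

(* Main.v *)
Require Import Defs.
From HB Require Import structures.
From mathcomp Require Import all_boot all_order all_algebra.
From mathcomp Require Import all_classical all_reals all_analysis.
From mathcomp Require Import measurable_realfun ring lra.

Import Order.TTheory GRing.Theory Num.Theory.
Import numFieldNormedType.Exports.

Local Open Scope classical_set_scope.
Local Open Scope ring_scope.

(** Why the theorem is true.  Along an orbit, [u t = f (act t L)] is harmonic
    on the whole of R^d.  If [p] is a strictly convex function then [p \o u] is
    subharmonic, with Laplacian [p'' (u) |grad u|^2].  But a Laplacian along the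
    orbits integrates to zero against an invariant measure, so this nonnegative
    quantity vanishes almost everywhere: [f] is almost everywhere constant along
    orbits, hence almost everywhere constant by ergodicity.  Liouville's theorem
    and the pointwise ergodic theorem are both avoided, and the integrability
    required of [p \o f] is what the hypotheses on [f] provide.

    One family of functions serves all cases: [profile s x = sqrt (1 + x^2) - s x]
    is strictly convex for every [s] and nonnegative for [`|s| <= 1].  It is
    bounded on half-lines bounded below if [s = 1], on half-lines bounded above
    if [s = -1], and of linear growth if [s = 0], which gives the three
    integrability lemmas [L1_profile1], [L1_profileN1] and [L1_profile0].

    The integral of the Laplacian is handled by finite differences, so that only
    finite sums of translates are integrated.  A second difference quotient of
    step [h] has coefficients of order [h^-2], and passing to the limit under the
    integral needs a bound independent of [h].  Averaging twice in each direction
    over the [N] points of a grid of step [h = eta / N] telescopes the second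
    differences, and the averaged discrete Laplacian becomes a combination of
    translates whose coefficients sum to zero and have total mass at most
    [4 d / eta^2], whatever [N] is: this is [averaged_laplacian].  Applied to
    [g = profile s \o f] it yields functions [X_N] of integral zero, uniformly
    integrable in [N], and with negative parts that tend to zero pointwise, by
    [dlap_profile_harmonic] and compactness.  Hence [X_N] tends to zero in L^1,
    and almost surely [X_N] is not eventually above a positive constant
    ([not_eventually_ge]).  A nonzero gradient at the origin would keep [X_N]
    above such a constant for [eta] small, so the gradient of [f] along the
    orbits vanishes almost everywhere ([ae_gradient_eq0]).  Countably many
    rational points on each coordinate line and continuity of the partial
    derivatives then give [f (act t L) = f L] for almost every [L], for each [t].

    In dimension one no integrability is available, but [f] is affine along the
    orbits.  Its slope is an invariant function, hence almost everywhere a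
    constant [c], and [f] is shifted by [c] under a measure preserving map; this
    forces [c = 0] ([ae_shift_eq0]).

    Unique ergodicity gives ergodicity: the normalized restriction of [mu] to an
    invariant set of positive measure is an invariant probability, so it is
    [mu] ([invariant_set_trivial], [invariant_ae_constant]). *)

(** * Weighted sums of translates and the averaged discrete Laplacian *)

Section weighted_shifts.
Context {R : realFieldType} {V : lmodType R}.
Implicit Types (nu pi : seq (R * V)) (G : V -> R) (x e : V).

(** A list of weights and vectors stands for a finitely supported signed measure
    on [V]. *)
Definition convol nu G x : R := \sum_(p <- nu) p.1 * G (x + p.2).

Definition mass nu : R := \sum_(p <- nu) `|p.1|.

Definition scale_weights (c : R) nu := [seq (c * p.1, p.2) | p <- nu].

(** Convolution of two finitely supported signed measures. *)
Definition star nu pi := [seq (p.1 * q.1, p.2 + q.2) | p <- nu, q <- pi].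

Lemma convol_star nu pi G : convol (star nu pi) G = convol nu (convol pi G).
Proof.
apply/funext => x; rewrite /convol big_allpairs_dep; apply: eq_bigr => p _.
by rewrite mulr_sumr; apply: eq_bigr => q _; rewrite mulrA addrA.
Qed.

Lemma convol_scale c nu G x : convol (scale_weights c nu) G x = c * convol nu G x.
Proof.
rewrite /convol big_map mulr_sumr; apply: eq_bigr => p _ /=.
by rewrite mulrA.
Qed.

Lemma mass_star nu pi : mass (star nu pi) = mass nu * mass pi.
Proof.
rewrite /mass big_allpairs_dep mulr_suml; apply: eq_bigr => p _.
by rewrite mulr_sumr; apply: eq_bigr => q _; rewrite normrM.
Qed.

Lemma mass_scale c nu : mass (scale_weights c nu) = `|c| * mass nu.
Proof.
by rewrite /mass big_map mulr_sumr; apply: eq_bigr => p _; rewrite normrM.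
Qed.

Lemma convolC nu pi G : convol nu (convol pi G) = convol pi (convol nu G).
Proof.
apply/funext => x; rewrite /convol.
under eq_bigr do rewrite mulr_sumr.
rewrite exchange_big /=; apply: eq_bigr => p _.
by rewrite mulr_sumr; apply: eq_bigr => q _; rewrite mulrCA -!addrA (addrC p.2).
Qed.

Definition steps e N : seq (R * V) :=
  [seq (N%:R^-1, e *+ k) | k <- iota 0 N].

Definition sdiff e : seq (R * V) := [:: (1, e); (1, - e); (- 2, 0)].

Lemma convol_steps e N G x :
  convol (steps e N) (fun y => G (y + e) - G y) x
    = N%:R^-1 * (G (x + e *+ N) - G x).
Proof.
rewrite /convol big_map -mulr_sumr; congr (_ * _).
have -> : \sum_(k <- iota 0 N) (G (x + e *+ k + e) - G (x + e *+ k)) =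
    \sum_(0 <= k < N) (G (x + e *+ k.+1) - G (x + e *+ k)).
  rewrite /index_iota subn0; apply: eq_bigr => k _.
  by rewrite mulrSr addrA.
by rewrite telescope_sumr// mulr0n addr0.
Qed.

(** With [D] the forward difference of step [e], the centered second difference
    is [D] applied twice and shifted back by [e]; each average absorbs one [D]
    and leaves a difference of step [N e], divided by [N]. *)
Lemma convol_steps_sdiff e N G :
  convol (steps e N) (convol (steps e N) (convol (sdiff e) G)) =
  convol (scale_weights (N%:R ^- 2)
    [:: (1, e *+ N *+ 2 - e); (- 2, e *+ N - e); (1, - e)]) G.
Proof.
pose G1 y := G (y - e + e) - G (y - e).
have -> : convol (sdiff e) G = fun y => G1 (y + e) - G1 y.
  apply/funext => y; rewrite /convol !big_cons big_nil /G1 /= addrK !subrK !addr0.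
  ring.
have -> : convol (steps e N) (fun y => G1 (y + e) - G1 y) =
    fun y => N%:R^-1 * (G1 (y + e *+ N) - G1 y).
  by apply/funext => y; exact: convol_steps.
pose G2 y := N%:R^-1 * (G (y + e *+ N - e) - G (y - e)).
rewrite (_ : (fun y => _) = fun y => G2 (y + e) - G2 y); last first.
  apply/funext => y; rewrite /G1 /G2 !subrK [y + e + _]addrAC !addrK; ring.
apply/funext => x; rewrite convol_steps convol_scale /convol !big_cons big_nil
  /G2 /=.
rewrite mulr2n !addrA -[N%:R ^- 2]exprVn.
ring.
Qed.

Context {I : eqType} (e : I -> V) (N : nat).

(** One double average for each direction of [s]: a tensor product of discrete
    tent functions. *)
Fixpoint box_avg (s : seq I) : seq (R * V) :=
  if s is i :: s' then star (steps (e i) N) (star (steps (e i) N) (box_avg s'))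
  else [:: (1, 0)].

(** Shifts commute, so the two averages in direction [i] can be brought next to
    the second difference in that direction, which they telescope. *)
Lemma box_avg_sdiff s i : i \in s ->
  exists2 nu, mass nu <= 4 * N%:R ^- 2 * mass (box_avg (rem i s)) &
  forall G, convol (box_avg s) (convol (sdiff (e i)) G) = convol nu G.
Proof.
elim: s => // j s IH; rewrite inE /=; have [->|ji] := eqVneq j i => /=.
  move=> _; exists (star (box_avg s) (scale_weights (N%:R ^- 2)
    [:: (1, e i *+ N *+ 2 - e i); (- 2, e i *+ N - e i); (1, - e i)])).
    rewrite mass_star mulrC ler_wpM2r//; first exact: sumr_ge0.
    rewrite mass_scale /mass !big_cons big_nil /= normr1 normrN.
    rewrite ger0_norm ?invr_ge0 ?exprn_ge0// ger0_norm// mulrC.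
    by rewrite ler_wpM2r ?invr_ge0 ?exprn_ge0//; lra.
  move=> G; rewrite !convol_star -convol_steps_sdiff.
  by rewrite [convol (steps _ _) (convol (box_avg s) _)]convolC convolC.
move=> /IH[nu nuM nuE].
exists (star (steps (e j) N) (star (steps (e j) N) nu)).
  rewrite !mass_star !mulrA.
  set a := mass (steps _ _).
  apply: (@le_trans _ _ (a * a * (4 * N%:R ^- 2 * mass (box_avg (rem i s))))).
    by rewrite ler_wpM2l// mulr_ge0//; exact: sumr_ge0.
  by rewrite le_eqVlt; apply/orP; left; apply/eqP; ring.
by move=> G; rewrite !convol_star nuE.
Qed.

Hypothesis N_gt0 : (0 < N)%N.

Lemma mass_steps i : mass (steps (e i) N) = 1.
Proof.
rewrite /mass big_map /= big_const_seq count_predT size_iota iter_addr_0.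
by rewrite ger0_norm ?invr_ge0// -[LHS]mulr_natr mulVf// pnatr_eq0 -lt0n.
Qed.

Lemma mass_box_avg s : mass (box_avg s) = 1.
Proof.
elim: s => [|i s IH] /=; first by rewrite /mass big_seq1 normr1.
by rewrite !mass_star IH mass_steps !mulr1.
Qed.

Lemma box_avg_ge0 s p : p \in box_avg s -> 0 <= p.1.
Proof.
have sge0 i q : q \in steps (e i) N -> 0 <= q.1.
  by move=> /mapP[k _ ->] /=; rewrite invr_ge0.
elim: s p => [|i s IH] p /=; first by rewrite inE => /eqP ->.
by move=> /allpairsP[[a b] /= [/sge0 a0 /allpairsP[[a' b'] /= [/sge0 a0' /IH b0
  ->]] ->]];
  rewrite /= !mulr_ge0.
Qed.

Lemma convol_box_avg_ge s G x (c : R) :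
  (forall p, p \in box_avg s -> c <= G (x + p.2)) -> c <= convol (box_avg s) G x.
Proof.
move=> cG; rewrite -[c]mul1r -(mass_box_avg s) /mass mulr_suml /convol.
rewrite big_seq [leRHS]big_seq; apply: ler_sum => p ps.
have p0 := box_avg_ge0 _ _ ps.
by rewrite ger0_norm// ler_wpM2l// cG.
Qed.

End weighted_shifts.

Section discrete_laplacian.
Context {R : realType} {d : nat}.
Implicit Types (G : 'rV[R]_d -> R) (x : 'rV[R]_d) (h : R).

Definition dlap h G x : R :=
  \sum_i (G (x + h *: unit_vec i) + G (x - h *: unit_vec i) - 2 * G x) / h ^+ 2.

Lemma norm_unit_vec (i : 'I_d) : `|unit_vec i : 'rV[R]_d| <= 1.
Proof.
rewrite [leLHS]mx_normrE; apply: bigmax_le => // -[a b] _ /=.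
by rewrite mxE; case: (_ && _); rewrite ?normr1 ?normr0.
Qed.

Lemma norm_box_avg h N (s : seq 'I_d) p : 0 <= h ->
  p \in box_avg (fun i => h *: unit_vec i) N s ->
  `|p.2| <= (size s)%:R * (2 * N%:R * h).
Proof.
move=> h0; have sb (i : 'I_d) (q : R * 'rV[R]_d) :
    q \in steps (h *: unit_vec i) N -> `|q.2| <= N%:R * h.
  move=> /mapP[k]; rewrite mem_iota => /andP[_ kN] -> /=.
  rewrite -scaler_nat scalerA normrZ normrM normr_nat (ger0_norm h0).
  rewrite -[leRHS]mulr1 ler_pM ?norm_unit_vec ?mulr_ge0//.
  by rewrite ler_wpM2r// ler_nat ltnW.
elim: s p => [|i s IH] p /=.
  by rewrite inE => /eqP ->; rewrite normr0 mul0r.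
move=> /allpairsP[[a b] /= [/sb a0 /allpairsP[[a' b'] /= [/sb a0' /IH b0 ->]]
  ->]].
rewrite /= (le_trans (ler_normD _ _))// (le_trans (lerD (lexx _) (ler_normD _
  _)))//.
rewrite -natr1; move: b0; lra.
Qed.

(** The crucial point is that the bound on the mass of [nu] does not depend on
    [N], whereas the coefficients of [dlap (eta / N)] grow like [N ^ 2]; the last
    clause holds because [nu] is at the same time an average of discrete
    Laplacians taken at points of norm at most [2 d eta]. *)
Lemma averaged_laplacian (eta : R) (N : nat) : 0 < eta -> (0 < N)%N ->
  exists nu : seq (R * 'rV[R]_d),
  [/\ mass nu <= d%:R * 4 / eta ^+ 2, \sum_(p <- nu) p.1 = 0 &
  forall G x c, (forall t, `|t| <= d%:R * (2 * eta) ->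
     c <= dlap (eta / N%:R) G (x + t)) -> c <= convol nu G x].
Proof.
move=> eta0 N0; pose h := eta / N%:R.
have N0' : 0 < N%:R :> R by rewrite ltr0n.
have h0 : 0 < h by rewrite divr_gt0.
pose e (i : 'I_d) : 'rV[R]_d := h *: unit_vec i.
pose s := enum 'I_d; pose pi := box_avg e N s.
have /choice[nu_ nuP] : forall i, exists nu, mass nu <= 4 * N%:R ^- 2 /\
    forall G, convol pi (convol (sdiff (e i)) G) = convol nu G.
  move=> i; have [nu nuM nuE] := @box_avg_sdiff _ _ _ e N s i (mem_enum _ i).
  by exists nu; split => //; move: nuM; rewrite mass_box_avg// mulr1.
pose nu := flatten [seq scale_weights (h ^- 2) (nu_ i) | i <- s].
have nuE G x : convol nu G x = convol pi (dlap h G) x.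
  transitivity (\sum_i h ^- 2 * convol pi (convol (sdiff (e i)) G) x).
    rewrite /convol big_flatten big_map big_enum /=; apply: eq_bigr => i _.
    by rewrite -/(convol _ _ _) convol_scale -(nuP i).2.
  rewrite [RHS]/convol /dlap.
  under [RHS]eq_bigr do rewrite mulr_sumr.
  rewrite exchange_big /=; apply: eq_bigr => i _.
  rewrite mulr_sumr; apply: eq_bigr => p _.
  rewrite /convol !big_cons big_nil /= !addr0 /e; ring.
exists nu; split.
- rewrite /mass big_flatten big_map big_enum /=.
  apply: (@le_trans _ _ (\sum_(i < d) 4 / eta ^+ 2)).
    apply: ler_sum => i _; rewrite -/(mass _) mass_scale.
    have [nuM _] := nuP i.
    rewrite ger0_norm ?invr_ge0 ?exprn_ge0 ?(ltW h0)//.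
    apply: (@le_trans _ _ (h ^- 2 * (4 * N%:R ^- 2))).
      by rewrite ler_wpM2l ?invr_ge0 ?exprn_ge0 ?(ltW h0).
    rewrite le_eqVlt; apply/orP; left; apply/eqP; rewrite /h; field.
    by rewrite !gt_eqF.
  by rewrite sumr_const card_ord -[leLHS]mulr_natl mulrA.
- have := nuE (fun=> 1) 0; rewrite /convol; under eq_bigr do rewrite mulr1.
  move=> ->; rewrite big1// => p _.
  by rewrite /dlap big1 ?mulr0// => i _; rewrite (_ : _ - _ = 0) ?mul0r//; lra.
- move=> G x c cG; rewrite nuE; apply: convol_box_avg_ge => // p ps.
  apply: cG; have := @norm_box_avg h N s p (ltW h0) ps.
  rewrite size_enum_ord (_ : 2 * N%:R * h = 2 * eta)//.
  by rewrite /h; field; rewrite gt_eqF.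
Qed.

End discrete_laplacian.

(** * Strictly convex functions of at most linear growth *)

Section convex_profile.
Context {R : realType}.
Implicit Types (s a b x : R).

Definition profile s x : R := Num.sqrt (1 + x ^+ 2) - s * x.

(** The derivative of [profile s]. *)
Definition slope s x : R := x / Num.sqrt (1 + x ^+ 2) - s.

Let root x : R := Num.sqrt (1 + x ^+ 2).

Let sqr_root x : root x ^+ 2 = 1 + x ^+ 2.
Proof. by rewrite sqr_sqrtr// addr_ge0// sqr_ge0. Qed.

Let root_ge1 x : 1 <= root x.
Proof. by rewrite -[leLHS]sqrtr1 ler_wsqrtr// lerDl sqr_ge0. Qed.

Let root_ge0 x : 0 <= root x.
Proof. exact: sqrtr_ge0. Qed.

Let norm_le_root x : `|x| <= root x.
Proof. by rewrite -sqrtr_sqr ler_wsqrtr// lerDr. Qed.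

(** With [A = sqrt (1 + a^2)] and [B = sqrt (1 + b^2)] everything reduces to
    [(A B - (1 + a b)) (A B + (1 + a b)) = (b - a)^2] and to the bound
    [1 + a b <= A B]. *)
Lemma profile_convex s a b :
  profile s a + slope s a * (b - a) +
    (b - a) ^+ 2 / (2 * (1 + a ^+ 2) * (1 + b ^+ 2)) <= profile s b.
Proof.
rewrite /profile /slope -/(root a) -/(root b) -!sqr_root.
have := root_ge1 a; have := root_ge1 b; have := sqr_root a; have := sqr_root b.
move: (root a) (root b) => A B BE AE B1 A1.
have A0 : 0 < A by lra.
have B0 : 0 < B by lra.
have ABE : (A * B - (1 + a * b)) * (A * B + (1 + a * b)) = (b - a) ^+ 2.
  rewrite -subr_sqr exprMn AE BE; ring.
have ABge : `|1 + a * b| <= A * B.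
  rewrite -(ler_pXn2r (n := 2))// ?nnegrE ?mulr_ge0 ?(ltW A0) ?(ltW B0)//.
  rewrite real_normK ?num_real// -subr_ge0 subr_sqr ABE; exact: sqr_ge0.
have [AB1 AB2] : 0 <= A * B - (1 + a * b) /\ A * B + (1 + a * b) <= 2 * (A * B).
  by move: ABge; rewrite ler_norml => /andP[]; split; lra.
have key : (b - a) ^+ 2 / (2 * A * B ^+ 2) <= A * B - (1 + a * b).
  rewrite ler_pdivrMr ?mulr_gt0 ?exprn_gt0//.
  rewrite -ABE ler_wpM2l// (le_trans AB2)// -mulrA ler_pM2l// expr2.
  by rewrite ler_wpM2l ?(ltW A0)// ler_peMl// ltW.
(* The gap between [profile s b] and the tangent at [a] is the first factor
   of [ABE] divided by [A]. *)
have -> : B - s * b = A - s * a + (a / A - s) * (b - a) +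
    (A * B - (1 + a * b)) / A.
  have A20 : 1 + a ^+ 2 != 0 by rewrite -AE gt_eqF// exprn_gt0.
  have -> : A - s * a = (1 + a ^+ 2) / A - s * a by rewrite -AE; field; lra.
  by field; lra.
rewrite lerD2l ler_pdivlMr//; move: key; congr (_ <= _).
by field; apply/andP; lra.
Qed.

Lemma profile_ge0 s x : `|s| <= 1 -> 0 <= profile s x.
Proof.
move=> s1; rewrite subr_ge0 (le_trans (ler_norm _))// normrM.
rewrite (le_trans _ (norm_le_root x))//.
by rewrite ler_piMl.
Qed.

Lemma profile_le s x : profile s x <= 1 + `|x| - s * x.
Proof.
rewrite lerD2r -(ler_pXn2r (n := 2))// ?nnegrE ?addr_ge0//.
by rewrite sqr_root sqrrD expr1n real_normK ?num_real// mul1r lerD2r lerDl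
  mulrn_wge0.
Qed.

Lemma norm_slope s x : `|s| <= 1 -> `|slope s x| <= 2.
Proof.
move=> s1; rewrite (le_trans (ler_normB _ _))// (natrD _ 1 1) lerD//.
rewrite normrM normfV (ger0_norm (root_ge0 x)).
by rewrite ler_pdivrMr ?mul1r// (lt_le_trans ltr01).
Qed.

Lemma continuous_profile s : continuous (profile s).
Proof.
move=> x; apply: cvgB; last by apply: cvgM; [exact: cvg_cst|exact: cvg_id].
apply: (cvg_comp (fun x => 1 + x ^+ 2) Num.sqrt); last exact: sqrt_continuous.
by apply: cvgD; [exact: cvg_cst|exact: exprn_continuous].
Qed.

End convex_profile.

Section dlap_profile.
Context {R : realType} {d : nat}.

(** Discrete form of [Lap (p \o u) = p' (u) Lap u + p'' (u) |grad u|^2]: apply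
    [profile_convex] at the two neighbours of [x] in each direction, keeping the
    quadratic term of only one of them. *)
Lemma dlap_profile_ge s (u : 'rV[R]_d -> R) x (h : R) : 0 < h ->
  slope s (u x) * dlap h u x + \sum_i ((u (x + h *: unit_vec i) - u x) / h) ^+ 2 /
    (2 * (1 + u x ^+ 2) * (1 + u (x + h *: unit_vec i) ^+ 2))
  <= dlap h (profile s \o u) x.
Proof.
move=> h0; rewrite /dlap mulr_sumr -big_split; apply: ler_sum => i _ /=.
rewrite exprMn exprVn [_ / h ^+ 2 / _]mulrAC mulrA -mulrDl.
rewrite ler_pM2r ?invr_gt0 ?exprn_gt0//.
have := profile_convex s (u x) (u (x + h *: unit_vec i)).
have := profile_convex s (u x) (u (x - h *: unit_vec i)).
have : 0 <= (u (x - h *: unit_vec i) - u x) ^+ 2 /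
    (2 * (1 + u x ^+ 2) * (1 + u (x - h *: unit_vec i) ^+ 2)).
  by rewrite divr_ge0 ?sqr_ge0// !mulr_ge0// addr_ge0 ?sqr_ge0.
lra.
Qed.

End dlap_profile.

(** * Second difference quotients of harmonic functions *)

Section directional_mvt.
Context {R : realType} {V : normedModType R}.
Implicit Types (u : V -> R) (x v : V) (h : R).

(** Only directional derivability is at hand, so the line is not treated by a
    chain rule but by unfolding the difference quotients, which coincide. *)
Lemma is_derive_line u x v s : derivable u (x + s *: v) v ->
  is_derive s (1 : R) (fun r => u (x + r *: v)) ('D_v u (x + s *: v)).
Proof.
move=> du.
have E : (fun h : R => h^-1 *: (((fun r => u (x + r *: v)) \o shift s) (h *: 1)
    - u (x + s *: v))) =
  (fun h : R => h^-1 *: ((u \o shift (x + s *: v)) (h *: v) - u (x + s *: v))).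
  apply/funext => h /=; rewrite [h *: 1]mulr1 scalerDl addrCA; congr (_ *: _).
apply: DeriveDef; first by rewrite /derivable E.
by rewrite /derive E.
Qed.

Lemma mvt_line u x v h : 0 < h ->
  (forall s, 0 <= s <= h -> derivable u (x + s *: v) v) ->
  exists2 s, 0 < s < h & u (x + h *: v) - u x = h * 'D_v u (x + s *: v).
Proof.
move=> h0 du.
have dl s : 0 <= s <= h -> is_derive s (1 : R) (fun r =>
  u (x + r *: v)) ('D_v u (x + s *: v)).
  by move=> /du; exact: is_derive_line.
have [| |s sh] := @MVT _ (fun r => u (x + r *: v)) (fun s =>
  'D_v u (x + s *: v)) 0 h h0.
- by move=> s; rewrite in_itv /= => /andP[s0 sh]; apply: dl; rewrite !ltW.
- apply: derivable_within_continuous => s; rewrite in_itv /= => /dl.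
  by case.
rewrite scale0r addr0 subr0 => ->; exists s; last by rewrite mulrC.
by move: sh; rewrite in_itv.
Qed.

(** The mean value theorem is used twice: for [y |-> u y - u (y - h v)], and then
    for ['D_v u] between the two points that appear. *)
Lemma second_difference_mvt u x v h : 0 < h ->
  (forall s, `|s| <= h -> derivable u (x + s *: v) v /\
    derivable ('D_v u) (x + s *: v) v) ->
  exists2 s, `|s| < h &
    u (x + h *: v) + u (x - h *: v) - 2 * u x =
      h ^+ 2 * 'D_v ('D_v u) (x + s *: v).
Proof.
move=> h0 du.
pose F y := u y - u (y - h *: v).
have shiftE y : y - h *: v = y + (- h) *: v by rewrite scaleNr.
have dF s : 0 <= s <= h -> is_derive (x + s *: v) v F
    ('D_v u (x + s *: v) - 'D_v u (x + s *: v - h *: v)).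
  move=> /andP[s0 sh].
  have h1 : is_derive (x + s *: v) v u ('D_v u (x + s *: v)).
    by apply/derivableP; apply: (du s _).1; rewrite ger0_norm.
  apply: is_deriveB.
  have du' : derivable u (x + s *: v - h *: v) v.
    by rewrite shiftE -addrA -scalerDl; apply: (du _ _).1; rewrite ler_norml; lra.
  have E : (fun h0 : R => h0^-1 *: (((fun y =>
    u (y - h *: v)) \o shift (x + s *: v)) (h0 *: v)
      - u (x + s *: v - h *: v))) =
    (fun h0 : R => h0^-1 *: ((u \o shift (x + s *: v - h *: v)) (h0 *: v)
      - u (x + s *: v - h *: v))).
    by apply/funext => k /=; rewrite !addrA.
  by apply: DeriveDef; [rewrite /derivable E|rewrite /derive E].
have [|s /andP[s0 sh]] := @mvt_line F x v h h0.
  by move=> s /dF[].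
have -> : 'D_v F (x + s *: v) =
    'D_v u (x + s *: v) - 'D_v u (x + s *: v - h *: v).
  by have [] := dF s; rewrite ?ltW// ?s0.
have [|r /andP[r0 rh]] := @mvt_line ('D_v u) (x + s *: v - h *: v) v h h0.
  move=> r /andP[r0 rh]; rewrite shiftE -!addrA -!scalerDl.
  by apply: (du _ _).2; rewrite ler_norml; lra.
rewrite subrK => ->; rewrite /F addrK => E; exists (s - h + r).
  by rewrite ltr_norml; lra.
move: E; rewrite !scalerDl scaleNr !addrA.
lra.
Qed.

End directional_mvt.

Section local_estimates.
Context {R : realType} {d : nat}.
Implicit Types (u : 'rV[R]_d -> R).

Lemma near_ball (P : 'rV[R]_d -> Prop) (x : 'rV[R]_d) : (\forall y \near x,
  P y) ->
  exists2 r : R, 0 < r & forall y, `|y - x| < r -> P y.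
Proof.
move=> /nbhs_normP[r /= r0 rP]; exists r => // y yr; apply: rP.
by rewrite /ball_ /= distrC.
Qed.

(** A second difference quotient is a second derivative at a nearby point, and
    the second derivatives at [x] add up to zero. *)
Lemma dlap_harmonic_small u (U : set 'rV[R]_d) x (eps : R) : open U -> U x ->
  euclidean_harmonic_on U u -> 0 < eps ->
  exists2 r : R, 0 < r & forall t h, `|t - x| < r -> 0 < h < r ->
    `|dlap h u t| <= eps.
Proof.
move=> oU Ux [C2 lap0] e0.
pose D2 (i : 'I_d) := 'D_(unit_vec i) ('D_(unit_vec i) u).
have d10 : 0 < d%:R + 1 :> R by rewrite ltr_wpDl.
have : \forall y \near x, U y /\ forall i, `|D2 i y - D2 i x| < eps / (d%:R + 1).
  apply: filterI; first exact: open_nbhs_nbhs.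
  apply: (@filter_forall _ _
    (fun i y => `|D2 i y - D2 i x| < eps / (d%:R + 1)) (nbhs x)) => i.
  have [_ /(_ i)[_ _ /(_ i)[_ c]]] := C2 _ Ux.
  have /cvgrPdist_lt/(_ _ (divr_gt0 e0 d10)) := c.
  by apply: filterS => y; rewrite distrC.
move=> /near_ball[r r0 rP]; exists (r / 2); first by rewrite divr_gt0.
move=> t h tr /andP[h0 hr].
have inr i s : `|s| <= h -> `|t + s *: unit_vec i - x| < r.
  move=> sh; rewrite addrAC (le_lt_trans (ler_normD _ _))//.
  have : `|s *: (unit_vec i : 'rV[R]_d)| <= h.
    by rewrite normrZ (le_trans _ sh)// ler_piMr// norm_unit_vec.
  lra.
have /all_sig[xi xiP] : forall i, {y | `|y - x| < r /\
   (u (t + h *: unit_vec i) + u (t - h *: unit_vec i) - 2 * u t) / h ^+ 2 =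
     D2 i y}.
  move=> i; apply: cid.
  have [|s sh sE] := @second_difference_mvt _ _ u t (unit_vec i) h h0.
    move=> s /(inr i) /rP[/C2[_ /(_ i)[? _ /(_ i)[? _]]] _]; by split.
  exists (t + s *: unit_vec i); split; first by apply: inr; exact: ltW.
  by rewrite sE mulrC mulKf// expf_neq0// gt_eqF.
have -> : dlap h u t = \sum_i (D2 i (xi i) - D2 i x).
  rewrite sumrB -/(laplacian u x) lap0// subr0; apply: eq_bigr => i _.
  by rewrite (xiP i).2.
rewrite (le_trans (ler_norm_sum _ _ _))//.
apply: (@le_trans _ _ (\sum_(i < d) eps / (d%:R + 1))).
  by apply: ler_sum => i _; apply/ltW/(rP _ (xiP i).1).2.
rewrite sumr_const card_ord -[leLHS]mulr_natl mulrA ler_pdivrMr//.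
by rewrite mulrC ler_pM2l//; lra.
Qed.

Lemma difference_quotient_away u (U : set 'rV[R]_d) x i : open U -> U x ->
  C2_on U u -> 'D_(unit_vec i) u x != 0 ->
  exists c : R, 0 < c /\ exists2 r : R, 0 < r & forall t h, `|t - x| < r ->
    0 < h < r ->
    c <= `|(u (t + h *: unit_vec i) - u t) / h|.
Proof.
move=> oU Ux C2 Dx0; pose D := 'D_(unit_vec i) u.
have Dx : 0 < `|D x| by rewrite normr_gt0.
exists (`|D x| / 2); split; first by rewrite divr_gt0.
have : \forall y \near x, U y /\ `|D x - D y| < `|D x| / 2.
  apply: filterI; first exact: open_nbhs_nbhs.
  have [_ /(_ i)[_ c _]] := C2 _ Ux.
  by have /cvgrPdist_lt := c; apply; exact: divr_gt0.
move=> /near_ball[r r0 rP]; exists (r / 2); first by rewrite divr_gt0.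
move=> t h tr /andP[h0 hr].
have inr s : 0 <= s <= h -> `|t + s *: unit_vec i - x| < r.
  move=> /andP[s0 sh]; rewrite addrAC (le_lt_trans (ler_normD _ _))//.
  have : `|s *: (unit_vec i : 'rV[R]_d)| <= h.
    by rewrite normrZ (le_trans _ sh)// ger0_norm// ler_piMr// norm_unit_vec.
  lra.
have [|s /andP[s0 sh] ->] := @mvt_line _ _ u t (unit_vec i) h h0.
  by move=> s /inr /rP[/C2[_ /(_ i)[]]].
rewrite mulrAC divff ?gt_eqF// mul1r.
have /inr/rP[_] : 0 <= s <= h by apply/andP; lra.
have := ler_normD (D x - D (t + s *: unit_vec i)) (D (t + s *: unit_vec i)).
rewrite subrK -/D.
lra.
Qed.

(** Two consequences of [dlap_profile_ge]: the term with the Laplacian of [u] is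
    negligible because [slope] is bounded, and the quadratic terms are
    nonnegative, bounded away from zero where the gradient is not zero. *)
Lemma dlap_profile_harmonic u (U : set 'rV[R]_d) x s : open U -> U x ->
  euclidean_harmonic_on U u -> `|s| <= 1 ->
  (forall eps : R, 0 < eps -> exists2 r : R, 0 < r & forall t h,
    `|t - x| < r -> 0 < h < r -> - eps <= dlap h (profile s \o u) t) /\
  (forall i, 'D_(unit_vec i) u x != 0 -> exists c : R, 0 < c /\
    exists2 r : R, 0 < r & forall t h,
    `|t - x| < r -> 0 < h < r -> c <= dlap h (profile s \o u) t).
Proof.
move=> oU Ux hu s1.
pose gap h t i := ((u (t + h *: unit_vec i) - u t) / h) ^+ 2 /
    (2 * (1 + u t ^+ 2) * (1 + u (t + h *: unit_vec i) ^+ 2)).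
have gap_ge0 h t i : 0 <= gap h t i.
  by rewrite divr_ge0 ?sqr_ge0// !mulr_ge0// addr_ge0 ?sqr_ge0.
have slopeM t h eps : `|dlap h u t| <= eps ->
  - (2 * eps) <= slope s (u t) * dlap h u t.
  move=> he; rewrite lerNl (le_trans (ler_norm _))// normrN normrM.
  by rewrite ler_pM// norm_slope.
split=> [eps e0|i Di].
  have [r r0 rP] := dlap_harmonic_small u U x (eps / 2) oU Ux hu (divr_gt0 e0
    (ltr0n _ 2)).
  exists r => // t h tr hr; have /andP[h0 _] := hr.
  have := slopeM t h _ (rP t h tr hr).
  have := dlap_profile_ge s u t h h0.
  have : 0 <= \sum_j gap h t j by apply: sumr_ge0 => j _.
  rewrite /gap; lra.
have [c0 [c00 [r1 r10 r1P]]] := difference_quotient_away u U x i oU Ux hu.1 Di.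
(* Near [x] the values of [u] stay below [`|u x| + 1] in absolute value, so
   the denominators of the quadratic terms are at most [2 M^2]. *)
pose M := 1 + (`|u x| + 1) ^+ 2.
have M0 : 0 < M by rewrite ltr_pwDl// sqr_ge0.
have [r2 r20 r2P] : exists2 r : R, 0 < r & forall y, `|y - x| < r ->
  1 + u y ^+ 2 <= M.
  apply: near_ball; have [cu _] := hu.1 _ Ux.
  have /cvgrPdist_lt/(_ _ ltr01) := cu; apply: filterS => y xy.
  rewrite lerD2l -(real_normK (num_real (u y))) lerXn2r ?nnegrE ?addr_ge0//.
  have := ler_normD (u x) (u y - u x); rewrite addrC subrK distrC; lra.
pose k := c0 ^+ 2 / (2 * M * M).
have k0 : 0 < k by rewrite divr_gt0 ?exprn_gt0 ?mulr_gt0.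
have [r3 r30 r3P] := dlap_harmonic_small u U x (k / 4) oU Ux hu (divr_gt0 k0
  (ltr0n _ 4)).
(* The slope term costs at most [2 * (k / 4)]. *)
exists (k / 2); split; first by rewrite divr_gt0.
exists (Num.min r1 (Num.min (r2 / 2) r3));
  first by rewrite !lt_min r10 r30 divr_gt0.
move=> t h; rewrite !lt_min => /and3P[t1 t2 t3] /andP[h0 /and3P[h1 h2 h3]].
have t4 : `|t - x| < r2 by lra.
have t5 : `|t + h *: unit_vec i - x| < r2.
  rewrite addrAC (le_lt_trans (ler_normD _ _))//.
  have : `|h *: (unit_vec i : 'rV[R]_d)| <= h.
    by rewrite normrZ gtr0_norm// ler_piMr ?norm_unit_vec// ltW.
  lra.
have gk : k <= gap h t i.
  have pos y : 0 < 1 + y ^+ 2 :> R by rewrite ltr_pwDl// sqr_ge0.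
  rewrite /k /gap ler_pM ?sqr_ge0 ?invr_ge0 ?mulr_ge0 ?(ltW M0)//.
    rewrite -[leRHS]real_normK ?num_real// lerXn2r ?nnegrE ?(ltW c00)//.
    by apply: r1P; rewrite ?h0.
  rewrite lef_pV2 ?posrE ?mulr_gt0//.
  by rewrite ler_pM ?mulr_ge0 ?(ltW (pos _))// ?ler_pM2l ?r2P.
have := slopeM t h _ (r3P t h t3 _); rewrite h0 h3 => /(_ isT).
have := dlap_profile_ge s u t h h0; rewrite (bigD1 i)//= -/(gap h t i).
have : 0 <= \sum_(j | j != i) gap h t j by apply: sumr_ge0 => j _.
lra.
Qed.

End local_estimates.

(** * Sequences of integral zero with vanishing negative parts *)

Section convergence_to_zero.
Context {R : realType} {disp : measure_display} {T : measurableType disp}.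
Variable mu : probability T R.
Implicit Types f g : T -> R.

Definition L1 f := mu.-integrable setT (EFin \o f).

Lemma L1_measurable f : L1 f -> measurable_fun setT f.
Proof. by move=> /measurable_int/measurable_EFinP. Qed.

Lemma L1_le f g : measurable_fun setT f -> L1 g ->
  (forall x, `|f x| <= g x) -> L1 f.
Proof.
move=> mf Lg fg; apply: le_integrable Lg => //; first exact/measurable_EFinP.
by move=> x _ /=; rewrite lee_fin (le_trans (fg x))// ler_norm.
Qed.

Lemma L1D f g : L1 f -> L1 g -> L1 (fun x => f x + g x).
Proof. exact: integrableD. Qed.

Lemma L1B f g : L1 f -> L1 g -> L1 (fun x => f x - g x).
Proof. exact: integrableB. Qed.

Lemma L1Z c f : L1 f -> L1 (fun x => c * f x).
Proof. exact: integrableZl. Qed.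

Lemma L1_cst c : L1 (fun=> c).
Proof. exact: finite_measure_integrable_cst. Qed.

Lemma L1_norm f : L1 f -> L1 (fun x => `|f x|).
Proof.
move=> Lf; apply: le_integrable (Lf) => //.
  by apply/measurable_EFinP; apply: measurableT_comp => //; exact: L1_measurable.
by move=> x _ /=; rewrite normr_id.
Qed.

Lemma L1_sum (I : Type) (s : seq I) (F : I -> T -> R) :
  (forall i, L1 (F i)) -> L1 (fun x => \sum_(i <- s) F i x).
Proof.
move=> LF; elim: s => [|i s IH].
  by under eq_fun do rewrite big_nil; exact: L1_cst.
by under eq_fun do rewrite big_cons; exact: L1D.
Qed.

Lemma Rintegral_sum (I : Type) (s : seq I) (F : I -> T -> R) :
  (forall i, L1 (F i)) ->
  (\int[mu]_x (\sum_(i <- s) F i x) = \sum_(i <- s) \int[mu]_x F i x)%R.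
Proof.
move=> LF; elim: s => [|i s IH].
  rewrite big_nil -[RHS](mul0r (fine (mu setT))) -Rintegral_cst//.
  by apply: eq_Rintegral => x _; rewrite big_nil.
rewrite big_cons -IH -RintegralD//; [|exact: LF|exact: L1_sum].
by apply: eq_Rintegral => x _; rewrite big_cons.
Qed.

(** Convergence to zero with explicit thresholds, since the estimates below are
    all of the form: for every index beyond [N]. *)
Definition to0 (u : nat -> R) := forall e, 0 < e ->
  exists N, forall n, (N <= n)%N -> `|u n| <= e.

Lemma to0P u : to0 u <-> u @ \oo --> 0.
Proof.
split=> [u0|/cvgr0Pnorm_le u0 e e0].
  apply/cvgr0Pnorm_le => e /u0[N uN]; exists N => // n /=; exact: uN.
by have [N _ uN] := u0 e e0; exists N => n Nn; exact: uN.
Qed.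

Lemma Rintegral_dominated_to0 (Y : nat -> T -> R) g :
  (forall n, measurable_fun setT (Y n)) -> L1 g ->
  (forall n x, `|Y n x| <= g x) -> (forall x, to0 (Y ^~ x)) ->
  to0 (fun n => \int[mu]_x Y n x)%R.
Proof.
move=> mY Lg Yg Y0; apply/to0P.
have [] := @dominated_convergence _ _ _ mu setT measurableT
  (fun n => EFin \o Y n) (cst 0%E) (EFin \o g).
- by move=> n; exact/measurable_EFinP.
- exact: measurable_cst.
- by apply: aeW => x _; apply/fine_cvgP; split;
  [exact: nearW|have /to0P := Y0 x].
- exact: Lg.
- by apply: aeW => x n _ /=; rewrite lee_fin.
by rewrite integral0 => _ _ /fine_cvg.
Qed.

(** The form in which almost everywhere vanishing is obtained below: an integral
    estimated up to every positive error. *)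
Lemma ae_norm_small f : L1 f -> (forall e, 0 < e -> (\int[mu]_x `|f x| <= e)%R) ->
  {ae mu, forall x, f x = 0}.
Proof.
move=> Lf f0.
have Lnf := L1_norm _ Lf.
have : ae_eq mu setT (EFin \o f) (cst 0%E).
  apply/ae_eq_integral_abs => //; first exact: measurable_int Lf.
  have E : (\int[mu]_x `|(f x)%:E| = (\int[mu]_x `|f x|)%R%:E)%E.
    rewrite /Rintegral fineK//; exact: integrable_fin_num.
  rewrite E; congr EFin; apply/eqP; rewrite eq_le Rintegral_ge0// andbT.
  by apply/ler_addgt0Pl => e /f0; rewrite addr0.
by apply: filterS => x /(_ I) [].
Qed.

(** The negative parts tend to zero in L^1, by dominated convergence for their
    truncations and uniform integrability for the rest.  As the integrals of the
    [X n] are zero, so do the positive parts, and Markov's inequality concludes.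
    The fourth hypothesis is uniform integrability, in the form: bounded up to
    an error small in L^1. *)
Lemma not_eventually_ge (X : nat -> T -> R) :
  (forall n, L1 (X n)) -> (forall n, \int[mu]_x X n x = 0)%R ->
  (forall x (e : R), 0 < e -> exists N, forall n, (N <= n)%N -> - e <= X n x) ->
  (forall e : R, 0 < e -> exists (K : R) (E : nat -> T -> R),
    [/\ forall n, L1 (E n), forall n x, 0 <= E n x,
        forall n, (\int[mu]_x E n x <= e)%R &
        forall n x, `|X n x| <= K + E n x]) ->
  {ae mu, forall x c, 0 < c -> ~ exists N, forall n, (N <= n)%N -> c <= X n x}.
Proof.
move=> LX X0 Xneg UI.
pose Y n x : R := Num.max 0 (- X n x).
have Y_ge0 n x : 0 <= Y n x by rewrite le_max lexx.
have YX n x : Y n x <= `|X n x|.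
  by rewrite ge_max normr_ge0 -normrN ler_norm.
have mY n : measurable_fun setT (Y n).
  apply: measurable_maxr => //; apply: measurableT_comp => //;
    exact: L1_measurable.
have LY n : L1 (Y n).
  by apply: L1_le (L1_norm _ (LX n)) _ => // x; rewrite ger0_norm.
have Y0 x : to0 (Y ^~ x).
  move=> e e0; have [N XN] := Xneg x e e0; exists N => n /XN XNn.
  rewrite ger0_norm// ge_max; apply/andP; lra.
have normX n x : `|X n x| = X n x + 2 * Y n x.
  by rewrite /Y maxEle; case: ler0P; case: ifPn; lra.
have intX (e : R) : 0 < e -> exists N, forall n, (N <= n)%N ->
  (\int[mu]_x `|X n x| <= e)%R.
  move=> e0; have [K [E [LE E0 Ee XE]]] := UI (e / 4) (divr_gt0 e0 (ltr0n _ 4)).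
  (* [Z n] is bounded by the constant part of the bound on [X n], and [Y n]
     exceeds it by at most [E n]. *)
  pose Z n x : R := Num.min (Y n x) `|K|.
  have mZ n : measurable_fun setT (Z n) by exact: measurable_minr.
  have Z0 n x : 0 <= Z n x by rewrite le_min Y_ge0 normr_ge0.
  have ZK n x : `|Z n x| <= `|K| by rewrite ger0_norm// ge_min lexx orbT.
  have LZ n : L1 (Z n) by exact: L1_le (L1_cst `|K|) _.
  have [|N ZN] := Rintegral_dominated_to0 Z _ mZ (L1_cst `|K|) ZK _ _
    (divr_gt0 e0 (ltr0n _ 4)).
    move=> x r /(Y0 x)[N YN]; exists N => n /YN.
    rewrite !ger0_norm//; apply: le_trans; by rewrite ge_min lexx.
  exists N => n /ZN Zn.
  have -> : (\int[mu]_x `|X n x| = \int[mu]_x (X n x + 2 * Y n x))%R.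
    by apply: eq_Rintegral => x _.
  rewrite RintegralD//; [|exact: LX|exact: L1Z].
  rewrite X0 add0r RintegralZl//; last exact: LY.
  have : (\int[mu]_x Y n x <= \int[mu]_x (Z n x + E n x))%R.
    apply: le_Rintegral => //; [exact: LY|exact: L1D|].
    move=> x _; rewrite /Z minEle; case: ifPn => _; first by rewrite lerDl.
    have := XE n x; have := YX n x; have := ler_norm K; lra.
  rewrite RintegralD//; [|exact: LZ|exact: LE].
  have := Ee n; have := ler_norm (\int[mu]_x Z n x)%R; lra.
have nuA N k : {ae mu, forall x, ~ forall n, (N <= n)%N -> k.+1%:R^-1 <= X n x}.
  pose A := \bigcap_(n in [set n | (N <= n)%N]) [set x | k.+1%:R^-1 <= X n x].
  have k0 : 0 < k.+1%:R^-1 :> R by rewrite invr_gt0.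
  have mA : measurable A.
    apply: bigcap_measurableType => n _.
    rewrite -[X in measurable X]setTI; apply: measurable_fun_le => //.
    exact: L1_measurable.
  exists A; split=> //; last first.
    by move=> x /=; rewrite not_notE => xA n /=; exact: xA.
  apply/eqP; rewrite eq_le measure_ge0 andbT; apply/lee_addgt0Pr => e e0.
  rewrite add0e.
  have [M XM] := intX (k.+1%:R^-1 * e) (mulr_gt0 k0 e0).
  have XMn := XM _ (leq_maxr N M); set n := maxn N M in XMn.
  have mX : measurable_fun setT (EFin \o X n) by exact: measurable_int (LX n).
  have := @le_integral_abse _ _ _ mu setT measurableT _ _ mX k0.
  have -> : (\int[mu]_x `|(EFin \o X n) x| = (\int[mu]_x `|X n x|)%R%:E)%E.
    by rewrite /Rintegral fineK//; apply: integrable_fin_num => //;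
      exact: L1_norm.
  have ABs : (mu A <=
      mu (setT `&` [set x | (k.+1%:R^-1)%:E <= `|(EFin \o X n) x|]))%E.
    apply: le_measure; rewrite ?inE//.
      rewrite setTI -[X in measurable X]setTI; apply: measurable_fun_le => //.
      apply: measurableT_comp => //; exact: L1_measurable.
    move=> x xA; split=> //=; rewrite lee_fin.
    by rewrite (le_trans (xA n (leq_maxl _ _)))// ler_norm.
  move=> mk; rewrite -(@lee_pmul2l _ (k.+1%:R^-1)%:E)//.
  apply: (le_trans (lee_wpmul2l _ ABs)); first by rewrite lee_fin ltW.
  by rewrite (le_trans mk)// -EFinM lee_fin.
have : {ae mu, forall x N k, ~ forall n, (N <= n)%N -> k.+1%:R^-1 <= X n x}.
  by apply: ae_foralln => N; apply: ae_foralln => k.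
apply: filterS => x Hx c c0 [N XN].
have [k kc] := ltr_add_invr c0; rewrite add0r in kc.
by apply: (Hx N k) => n /XN; apply: le_trans; exact: ltW.
Qed.

End convergence_to_zero.

(** * Measure preserving maps and unique ergodicity *)

Section measure_preserving.
Context {R : realType} {disp : measure_display} {T : measurableType disp}.
Variable mu : probability T R.

Lemma ae_not_false : ~ {ae mu, forall x : T, False}.
Proof.
move=> [N [mN N0 subN]].
have NT : N = setT by apply/seteqP; split=> // x _; apply: subN.
by move: N0; rewrite NT probability_setT => /eqP; rewrite onee_eq0.
Qed.

Lemma ae_iff_measure (A B : set T) : measurable A -> measurable B ->
  {ae mu, forall x, A x <-> B x} -> mu A = mu B.
Proof.
move=> mA mB AB; rewrite -[A]setIT -[B]setIT -!integral_indic//.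
apply: ae_eq_integral => //.
- by apply/measurable_EFinP; exact: measurable_indic.
- by apply/measurable_EFinP; exact: measurable_indic.
- apply: filterS AB => x ABx _; rewrite /= !indicE; congr (_%:R%:E).
  by congr nat_of_bool; apply/idP/idP; rewrite !inE => /ABx.
Qed.

Lemma ae_eq_Rintegral (f g : T -> R) : measurable_fun setT f ->
  measurable_fun setT g ->
  {ae mu, forall x, f x = g x} -> (\int[mu]_x f x = \int[mu]_x g x)%R.
Proof.
move=> mf mg fg; congr fine; apply: ae_eq_integral => //.
- exact/measurable_EFinP.
- exact/measurable_EFinP.
- by apply: filterS fg => x /= -> _.
Qed.

Lemma ae_ge0_Rintegral0 (f : T -> R) : L1 mu f -> {ae mu, forall x, 0 <= f x} ->
  (\int[mu]_x f x = 0)%R -> {ae mu, forall x, f x = 0}.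
Proof.
move=> Lf f0 if0; apply: ae_norm_small => // e e0.
rewrite -(ae_eq_Rintegral f).
- by rewrite if0 ltW.
- exact: L1_measurable Lf.
- by apply: L1_measurable; exact: L1_norm Lf.
- by apply: filterS f0 => x fx; rewrite ger0_norm.
Qed.

(** Composing with [atan] makes any measurable function integrable without losing
    information, as [atan] is strictly increasing. *)
Lemma L1_atan (g : T -> R) : measurable_fun setT g -> L1 mu (fun x => atan (g x)).
Proof.
move=> mg; apply: L1_le (L1_cst mu (pi / 2)) _.
  apply: measurableT_comp mg; apply: continuous_measurable_fun => x.
  exact: continuous_atan.
by move=> x; rewrite ler_norml ltW ?atan_gtNpi2//= ltW// atan_ltpi2.
Qed.

Variable phi : T -> T.
Hypothesis mphi : measurable_fun setT phi.
Hypothesis phi_inv : forall A, measurable A -> mu (phi @^-1` A) = mu A.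

Lemma ae_comp (P : T -> Prop) : {ae mu, forall x, P x} ->
  {ae mu, forall x, P (phi x)}.
Proof.
move=> [N [mN N0 subN]]; exists (phi @^-1` N); split.
- by rewrite -[X in measurable X]setTI; exact: mphi.
- by rewrite -N0; exact: phi_inv.
- by move=> x; exact: subN.
Qed.

Let pushforwardE (f : T -> \bar R) :
  (\int[pushforward mu phi]_x f x = \int[mu]_x f x)%E.
Proof. by apply: eq_measure_integral => A mA _; exact: phi_inv. Qed.

Lemma L1_comp (f : T -> R) : L1 mu f -> L1 mu (f \o phi).
Proof.
move=> /integrableP[mf foo]; apply/integrableP; split.
  exact: (measurableT_comp mf mphi).
rewrite -pushforwardE ge0_integral_pushforward// in foo.
exact: measurableT_comp.
Qed.

Lemma Rintegral_comp (f : T -> R) : L1 mu f ->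
  (\int[mu]_x f (phi x) = \int[mu]_x f x)%R.
Proof.
move=> Lf; congr fine; rewrite -[RHS]pushforwardE.
rewrite integral_pushforward//; first exact: measurable_int Lf.
exact: L1_comp.
Qed.

(** If [c > 0], then [atan (g (phi x)) - atan (g x)] is positive almost everywhere
    although its integral is zero; the case [c < 0] is symmetric. *)
Lemma ae_shift_eq0 (g : T -> R) (c : R) : measurable_fun setT g ->
  {ae mu, forall x, g (phi x) = g x + c} -> c = 0.
Proof.
move=> mg gc; have [//|c0] := eqVneq c 0; exfalso.
pose a x : R := atan (g x).
have La : L1 mu a by exact: L1_atan.
have Lc : L1 mu (a \o phi) by exact: L1_comp.
have D0 : (\int[mu]_x (a (phi x) - a x) = 0)%R.
  by rewrite RintegralB// Rintegral_comp// subrr.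
have {}D0 : {ae mu, forall x, a (phi x) - a x = 0}.
  have /orP[c_gt0|c_lt0] : (0 < c) || (c < 0) by rewrite orbC -neq_lt.
    apply: ae_ge0_Rintegral0 => //; first exact: L1B.
    by apply: filterS gc => x gx; rewrite subr_ge0 /a gx le_atan// lerDl ltW.
  have : {ae mu, forall x, a x - a (phi x) = 0}.
    apply: ae_ge0_Rintegral0 => //; first exact: (L1B _ _ _ La Lc).
      by apply: filterS gc => x gx; rewrite subr_ge0 /a gx le_atan// gerDl ltW.
    by rewrite RintegralB// Rintegral_comp// subrr.
  by apply: filterS => x /eqP; rewrite subr_eq0 => /eqP ->; rewrite subrr.
apply: ae_not_false; apply: filterS2 gc D0 => x gx /eqP.
rewrite subr_eq0 /a gx => /eqP /(congr1 tan); rewrite !atanK => /eqP.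
by rewrite -subr_eq0 addrAC subrr add0r (negbTE c0).
Qed.

End measure_preserving.

Section unique_ergodicity.
Context {R : realType} {disp : measure_display} {T : measurableType disp}.
Context {I : Type}.
Variables (mu : probability T R) (tau : I -> T -> T).
Hypothesis mtau : forall t, measurable_fun setT (tau t).
Hypothesis tau_inv : forall t A, measurable A -> mu (tau t @^-1` A) = mu A.
Hypothesis mu_unique : forall nu : probability T R,
  (forall t A, measurable A -> nu (tau t @^-1` A) = nu A) ->
  forall A, measurable A -> nu A = mu A.

(** Otherwise [mu] conditioned on [A] would be a second invariant probability:
    it gives mass one to [A]. *)
Lemma invariant_set_trivial (A : set T) : measurable A ->
  (forall t, {ae mu, forall x, A (tau t x) <-> A x}) -> mu A = 0%E \/ mu A = 1%E.
Proof.
move=> mA Ainv; have [->|A0] := eqVneq (mu A) 0%E; [by left|right].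
have Afin : mu A \is a fin_num by exact: fin_num_measure.
have restrT : mrestr mu mA setT = mu A by rewrite /mrestr setTI.
pose nu := mnormalize (mrestr mu mA) mu.
have nuE B : nu B = (mu (B `&` A) * (fine (mu A))^-1%:E)%E.
  rewrite /nu /mnormalize /= restrT (negbTE A0) /=.
  by rewrite (_ : (mu A == +oo%E) = false)//; apply/negbTE; move: Afin;
    case: (mu A).
have nu_inv t B : measurable B -> nu (tau t @^-1` B) = nu B.
  move=> mB; rewrite !nuE; congr (_ * _)%E.
  have mpre C : measurable C -> measurable (tau t @^-1` C).
    by move=> mC; rewrite -[X in measurable X]setTI; exact: mtau.
  rewrite -(tau_inv t (B `&` A)); last exact: measurableI.
  rewrite preimage_setI; apply: ae_iff_measure.
  - by apply: measurableI => //; exact: mpre.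
  - by apply: measurableI; exact: mpre.
  - by apply: filterS (Ainv t) => x [A1 A2]; split=> -[? ?]; split=> //;
      [exact: A2|exact: A1].
have : nu A = mu A := mu_unique _ nu_inv A mA; rewrite nuE setIid.
rewrite -{1}(fineK Afin) -EFinM divff ?fine_eq0//.
Qed.

(** Comparing [atan \o g] with its mean [m] on the invariant set where it exceeds
    [m]: whether this set is null or full, [atan \o g - m] has almost surely a
    constant sign, and its integral is zero. *)
Lemma invariant_ae_constant (g : T -> R) : measurable_fun setT g ->
  (forall t, {ae mu, forall x, g (tau t x) = g x}) ->
  exists c, {ae mu, forall x, g x = c}.
Proof.
move=> mg ginv; pose a x : R := atan (g x).
have La : L1 mu a by exact: L1_atan.
pose m := (\int[mu]_x a x)%R.
have Lm : L1 mu (fun=> m) by exact: L1_cst.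
have im : (\int[mu]_x m = m)%R.
  rewrite (Rintegral_cst mu measurableT m).
  transitivity (m * fine 1%E); last by rewrite /= mulr1.
  by congr (_ * fine _); exact: (probability_setT mu).
suff : {ae mu, forall x, a x = m}.
  by exists (tan m); apply: filterS H => x <-; rewrite atanK.
pose A := [set x | m < a x].
have mA : measurable A.
  rewrite (_ : A = setT `&` a @^-1` [set` `]m, +oo[]).
    exact: (L1_measurable _ _ La).
  by rewrite setTI; apply/seteqP; split=> x /=; rewrite in_itv /= andbT.
have [t|A0|A1] := @invariant_set_trivial A mA.
- by apply: filterS (ginv t) => x gx; rewrite /A /= /a gx.
- have : {ae mu, forall x, m - a x = 0}.
    apply: ae_ge0_Rintegral0; first exact: L1B.
      by exists A; split=> // x /= /negP; rewrite subr_ge0 -ltNge.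
    by rewrite RintegralB// im subrr.
  by apply: filterS => x /eqP; rewrite subr_eq0 => /eqP.
- have : {ae mu, forall x, a x - m = 0}.
    apply: ae_ge0_Rintegral0; first exact: L1B.
      exists (~` A); split; first exact: measurableC.
        by rewrite probability_setC// A1 subee.
      by move=> x /= /negP; rewrite subr_ge0 -ltNge => ax max;
        have := lt_trans ax max; rewrite ltxx.
    by rewrite RintegralB// im subrr.
  by apply: filterS => x /eqP; rewrite subr_eq0 => /eqP.
Qed.

End unique_ergodicity.

(** * The translation action on the pattern space *)

Section translation_action.
Context {R : realType} {d : nat} {L0 : delone_set R d}.
Local Notation Omega := (pattern_space L0).
Implicit Types (L : Omega) (s t x : 'rV[R]_d) (f : Omega -> R).

Lemma act_add s t L : act s (act t L) = act (s + t) L.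
Proof.
apply: val_inj; apply: delone_set_inj; apply/seteqP; split=> x /=.
  by move=> /translateE/translateE; rewrite -addrA => ?; apply/translateE.
by move=> /translateE; rewrite addrA => ?; do 2 apply/translateE.
Qed.

Lemma act0 L : act 0 L = L.
Proof.
apply: val_inj; apply: delone_set_inj; apply/seteqP; split=> x /=.
  by move=> /translateE; rewrite addr0.
by move=> ?; apply/translateE; rewrite addr0.
Qed.

(** The Borel sets are generated by the open sets of the subspace topology, on
    which continuity of [phi t] applies. *)
Lemma measurable_act t : measurable_fun setT (act t : Omega -> Omega).
Proof.
apply: (@measurability _ _ _ _ _ _ (@open Omega)) => //.
move=> _ [_ [W oW <-] <-]; rewrite setTI; apply: sub_sigma_algebra.
exists (phi t @^-1` W) => //.
by apply: open_comp => // L _; exact: phi_continuous.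
Qed.

Lemma pullback_act f x L : pullback f (act x L) = fun t => pullback f L (t + x).
Proof. by apply/funext => t; rewrite /pullback act_add. Qed.

Lemma derive_translate (u : 'rV[R]_d -> R) x v :
  'D_v (fun t => u (t + x)) = fun t => 'D_v u (t + x).
Proof.
apply/funext => t; rewrite /derive.
by under eq_fun do rewrite /= -addrA.
Qed.

Lemma derive2_translate (u : 'rV[R]_d -> R) x v w :
  'D_w ('D_v (fun t => u (t + x))) = fun t => 'D_w ('D_v u) (t + x).
Proof. rewrite derive_translate; exact: (derive_translate ('D_v u)). Qed.

Lemma derivable_translate (u : 'rV[R]_d -> R) x v t :
  derivable (fun t => u (t + x)) t v = derivable u (t + x) v.
Proof.
by rewrite /derivable; under eq_fun do rewrite /= -addrA.
Qed.

Lemma continuous_at_translate (u : 'rV[R]_d -> R) x :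
  {for 0, continuous (fun t => u (t + x))} -> {for x, continuous u}.
Proof.
move=> cu; have uE : u = (fun t => u (t + x)) \o (fun y => y - x).
  by apply/funext => y /=; rewrite subrK.
rewrite uE; apply: continuous_comp; last by rewrite subrr.
apply: continuousB; last exact: cst_continuous.
exact: (@cvg_id _ (nbhs x)).
Qed.

(** Harmonicity near the origin of all orbit functions is harmonicity everywhere,
    since the orbit function of [act x L] is a translate of that of [L]. *)
Lemma harmonic_pullback f L : harmonic_in setT f ->
  euclidean_harmonic_on setT (pullback f L).
Proof.
move=> [_ hf]; split=> x _; have [U [_ U0]] := hf (act x L) I;
  rewrite pullback_act => -[C2 lap0].
  have [cu Du] := C2 _ U0; split; first exact: continuous_at_translate.
  move=> i; have [di ci dci] := Du i; split.
  - by move: di; rewrite derivable_translate add0r.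
  - by apply: continuous_at_translate; rewrite -derive_translate.
  - move=> j; have [dj cj] := dci j; split.
      move: dj; rewrite derive_translate.
      by rewrite (derivable_translate ('D_(unit_vec i) (pullback f L))) add0r.
    by apply: continuous_at_translate; rewrite -!derive_translate.
transitivity (laplacian (fun t => pullback f L (t + x)) 0); last exact: lap0.
apply: eq_bigr => i _.
have /(congr1 (fun F => F 0)) := derive2_translate (pullback f L) x (unit_vec i)
  (unit_vec i).
by rewrite /= add0r => ->.
Qed.

End translation_action.

(** * The gradient along the orbits vanishes almost everywhere *)

Section vanishing_gradient.
Context {R : realType} {d : nat} {L0 : delone_set R d}.
Local Notation Omega := (pattern_space L0).
Variables (mu : probability Omega R) (f : Omega -> R).
Hypotheses (mu_inv : Defs.invariant mu) (hf : harmonic_in setT f).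
Implicit Types (L : Omega) (s t x : 'rV[R]_d).

Lemma dlap_pullback_act (g : Omega -> R) L x t (h : R) :
  dlap h (pullback g (act x L)) t = dlap h (pullback g L) (t + x).
Proof.
apply: eq_bigr => i _; rewrite !pullback_act.
by rewrite (addrAC t x) (addrAC t x).
Qed.

Lemma compact_norm_ball (r : R) : compact [set t : 'rV[R]_d | `|t| <= r].
Proof.
apply: bounded_closed_compact.
  by exists r; split; [exact: num_real|move=> M rM t /= tr;
    exact: le_trans (ltW rM)].
apply: (@closed_comp _ _ (fun t : 'rV[R]_d => `|t|) [set y | y <= r]).
  by move=> t _; exact: norm_continuous.
exact: closed_le.
Qed.

(** Uniformity on the ball comes from compactness, in the form of the covering
    property for the filter of large [n]. *)
Lemma dlap_profile_eventually_ge (s : R) L (eta rho eps : R) : `|s| <= 1 ->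
  0 < eta -> 0 < eps ->
  exists N, forall n, (N <= n)%N -> forall t, `|t| <= rho ->
    - eps <= dlap (eta / n.+1%:R) (pullback (profile s \o f) L) t.
Proof.
move=> s1 eta0 e0.
pose P (n : nat) t := - eps <= dlap (eta / n.+1%:R)
  (pullback (profile s \o f) L) t.
have [/(_ (compact_norm_ball rho)) cover _] :=
  compact_near_coveringP [set t : 'rV[R]_d | `|t| <= rho].
have [|N _ NP] := cover nat \oo P _; last by exists N => n Nn t tr;
  exact: (NP n Nn).
move=> x _.
have [/(_ _ e0)[r r0 rP] _] :=
  dlap_profile_harmonic (pullback f (act x L)) setT 0 s openT I
    (harmonic_pullback _ _ hf) s1.
have [N NP] : exists N, forall n, (N <= n)%N -> eta / n.+1%:R < r.
  have [k] := ltr_add_invr (divr_gt0 r0 eta0); rewrite add0r => kr.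
  exists k => n kn; rewrite -ltr_pdivlMl// mulrC (le_lt_trans _ kr)//.
  by rewrite lef_pV2 ?posrE// ler_nat.
have nx : nbhs x [set t | `|t - x| < r].
  by apply/(nbhs_normP x (fun t => `|t - x| < r)); exists r => // y;
    rewrite /ball_ /= distrC.
exists ([set t | `|t - x| < r], [set n | (N <= n)%N]).
  by split => //=; exists N.
move=> [t n] /= [tr /NP nr]; rewrite /P -[t](subrK x) -dlap_pullback_act.
apply: rP; rewrite ?subr0//.
by rewrite nr divr_gt0.
Qed.

(** The sequence [X m] consists of averaged discrete Laplacians on boxes of side
    [2 * eta m], where [eta m = 1 / (m + 1)].  Uniform integrability in [n]
    comes from the uniform bound on the masses of the weights: split [g] into its
    truncation at a large level and a remainder small in L^1.  Small boxes are
    needed so that the whole box lies where the gradient is bounded away from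
    zero. *)
Lemma ae_gradient_eq0 (s : R) : `|s| <= 1 -> L1 mu (profile s \o f) ->
  {ae mu, forall L i, 'D_(unit_vec i) (pullback f L) 0 = 0}.
Proof.
move=> s1 Lg; pose g := profile s \o f.
have minv t A : measurable A -> mu (act t @^-1` A) = mu A by exact: mu_inv.
have mact := @measurable_act R d L0.
have Lact t (k : Omega -> R) : L1 mu k -> L1 mu (fun L => k (act t L)).
  by move=> Lk; exact: (L1_comp _ _ (mact t) (minv t)).
have Iact t (k : Omega -> R) : L1 mu k ->
  (\int[mu]_L k (act t L) = \int[mu]_L k L)%R.
  by move=> Lk; exact: (Rintegral_comp _ _ (mact t) (minv t)).
have g_ge0 L : 0 <= g L by exact: profile_ge0.
pose eta (m : nat) : R := m.+1%:R^-1.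
have eta0 m : 0 < eta m by rewrite invr_gt0.
have /choice[nu nuP] := fun mn : nat * nat =>
  @averaged_laplacian R d (eta mn.1) mn.2.+1 (eta0 _) isT.
pose X m n L := convol (nu (m, n)) (pullback g L) 0.
have XE m n L : X m n L = \sum_(p <- nu (m, n)) p.1 * g (act p.2 L).
  by apply: eq_bigr => p _; rewrite add0r.
have aeX m : {ae mu, forall L c, 0 < c -> ~ exists N, forall n, (N <= n)%N ->
  c <= X m n L}.
  apply: not_eventually_ge.
  - move=> n; rewrite (_ : X m n = fun L =>
      \sum_(p <- nu (m, n)) p.1 * g (act p.2 L)).
      by apply: L1_sum => p; apply: L1Z; exact: Lact.
    by apply/funext => L; exact: XE.
  - move=> n; have [_ nu0 _] := nuP (m, n).
    transitivity (\int[mu]_L \sum_(p <- nu (m, n)) p.1 * g (act p.2 L))%R.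
      by apply: eq_Rintegral => L _; exact: XE.
    rewrite Rintegral_sum; last by move=> p; apply: L1Z; exact: Lact.
    under eq_bigr => p _ do rewrite (RintegralZl _ measurableT (Lact p.2 _ Lg))
      (Iact p.2 _ Lg).
    by rewrite -mulr_suml nu0 mul0r.
  - move=> L e e0.
    have [N NP] :=
      dlap_profile_eventually_ge s L (eta m) (d%:R * (2 * eta m)) e s1 (eta0 m) e0.
    exists N => n Nn; have [_ _ H] := nuP (m, n); apply: H => t tr.
    by rewrite add0r; exact: NP.
  - move=> e e0; pose C : R := d%:R * 4 / eta m ^+ 2.
    have C0 : 0 <= C by rewrite divr_ge0 ?mulr_ge0 ?exprn_ge0 ?(ltW (eta0 m)).
    have C10 : 0 < C + 1 by lra.
    pose Y (k : nat) L : R := g L - Num.min (g L) k%:R.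
    have Y_ge0 k L : 0 <= Y k L by rewrite subr_ge0 ge_min lexx.
    have mg : measurable_fun setT g by exact: L1_measurable Lg.
    have mY k : measurable_fun setT (Y k).
      by apply: measurable_funB => //; exact: measurable_minr.
    have Yg k L : `|Y k L| <= g L.
      by rewrite ger0_norm// gerBl le_min g_ge0 ler0n.
    have [|k0 kP] := Rintegral_dominated_to0 mu Y g mY Lg Yg _ (e / (C + 1))
      (divr_gt0 e0 C10).
      move=> L r r0; exists (Num.bound (g L)) => k kb.
      rewrite (_ : Y k L = 0) ?normr0 ?ltW//.
      rewrite /Y (min_idPl _) ?subrr//.
      by rewrite (le_trans (ltW (archi_boundP (g_ge0 L))))// ler_nat.
    have LY : L1 mu (Y k0) by exact: L1_le Lg _.
    have iY := kP k0 (leqnn _).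
    exists (C * k0%:R), (fun n L => \sum_(p <- nu (m,
      n)) `|p.1| * Y k0 (act p.2 L)); split.
    + by move=> n; apply: L1_sum => p; apply: L1Z; exact: Lact.
    + by move=> n L; apply: sumr_ge0 => p _; rewrite mulr_ge0.
    + move=> n; rewrite Rintegral_sum; last by move=> p; apply: L1Z; exact: Lact.
      under eq_bigr => p _ do rewrite (RintegralZl _ measurableT (Lact p.2 _
        LY)) (Iact p.2 _ LY).
      rewrite -mulr_suml -/(mass _); have [nuC _ _] := nuP (m, n).
      have iY0 : 0 <= (\int[mu]_x Y k0 x)%R by apply: Rintegral_ge0 => x _.
      have {}iY := le_trans (ler_norm _) iY.
      apply: (@le_trans _ _ (C * (e / (C + 1)))).
        by rewrite ler_pM//; exact: sumr_ge0.
      by rewrite mulrCA ler_piMr ?(ltW e0)// ler_pdivrMr//; lra.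
    + move=> n L; rewrite XE (le_trans (ler_norm_sum _ _ _))//.
      have [nuC _ _] := nuP (m, n).
      apply: (@le_trans _ _ (mass (nu (m, n)) * k0%:R +
        \sum_(p <- nu (m, n)) `|p.1| * Y k0 (act p.2 L))).
        rewrite /mass mulr_suml -big_split; apply: ler_sum => p _ /=.
        rewrite normrM -mulrDr ler_wpM2l// ger0_norm//.
        by rewrite -lerBlDr /Y subKr ge_min lexx orbT.
      by rewrite lerD2r ler_wpM2r.
have : {ae mu, forall L m c, 0 < c -> ~ exists N, forall n, (N <= n)%N ->
  c <= X m n L}.
  exact: ae_foralln.
apply: filterS => L XL i; apply/eqP/negPn/negP => Di.
have [_ /(_ i Di)[c [c0 [r r0 rP]]]] :=
  dlap_profile_harmonic (pullback f L) setT 0 s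
  openT I (harmonic_pullback _ _ hf) s1.
have d0 : 0 < d%:R * 2 :> R.
  by rewrite mulr_gt0// ltr0n (leq_ltn_trans _ (ltn_ord i)).
(* [m] is such that the discrete Laplacians are taken at points of the ball
   of radius [r], where they are at least [c]. *)
have [m mr] := ltr_add_invr (divr_gt0 r0 d0); rewrite add0r ltr_pdivlMr// in mr.
have [N NP] : exists N, forall n, (N <= n)%N -> eta m / n.+1%:R < r.
  have [k] := ltr_add_invr (divr_gt0 r0 (eta0 m)); rewrite add0r => kr.
  exists k => n kn; rewrite -ltr_pdivlMl// mulrC (le_lt_trans _ kr)//.
  by rewrite lef_pV2 ?posrE// ler_nat.
apply: (XL m c c0); exists N => n Nn; have [_ _ H] :=
  nuP (m, n); apply: H => t tr.
rewrite add0r; apply: rP; last by rewrite NP// divr_gt0.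
by rewrite subr0 (le_lt_trans tr)// mulrA mulrC.
Qed.

End vanishing_gradient.

(** * From a vanishing gradient to invariance *)

Section invariance.
Context {R : realType} {d : nat} {L0 : delone_set R d}.
Local Notation Omega := (pattern_space L0).
Variables (mu : probability Omega R) (f : Omega -> R).
Hypotheses (mu_inv : Defs.invariant mu) (hf : harmonic_in setT f).
Implicit Types (L : Omega) (t x : 'rV[R]_d).

Let ae_act t (P : Omega -> Prop) : {ae mu, forall L, P L} ->
  {ae mu, forall L, P (act t L)}.
Proof. exact: (ae_comp _ _ (measurable_act t) (mu_inv t)). Qed.

Lemma derive_pullback_act L x v :
  'D_v (pullback f (act x L)) 0 = 'D_v (pullback f L) x.
Proof.
have /(congr1 (fun F => F 0)) := derive_translate (pullback f L) x v.
by rewrite /= add0r pullback_act => ->.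
Qed.

Lemma is_derive_pullback_line L i (r : R) :
  is_derive r (1 : R) (fun s => pullback f L (0 + s *: unit_vec i))
    ('D_(unit_vec i) (pullback f L) (0 + r *: unit_vec i)).
Proof.
apply: is_derive_line; have [C2 _] := harmonic_pullback f L hf.
by have [_ /(_ i)[]] := C2 (0 + r *: unit_vec i) I.
Qed.

(** The partial derivative is continuous on the line and the rationals are dense.
    Countably many conditions are what allows a single exceptional null set for
    all the points of the line. *)
Lemma constant_on_line L i :
  (forall q : rat, 'D_(unit_vec i) (pullback f L) (ratr q *: unit_vec i) = 0) ->
  forall r : R, f (act (r *: unit_vec i) L) = f L.
Proof.
move=> Dq r.
have D0 (s : R) : 'D_(unit_vec i) (pullback f L) (s *: unit_vec i) = 0.
  have [C2 _] := harmonic_pullback f L hf.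
  have [_ /(_ i)[_ cD _]] := C2 (s *: unit_vec i) I.
  apply/eqP/negPn/negP => Ds.
  have cl : {for s, continuous (fun r : R =>
    'D_(unit_vec i) (pullback f L) (r *: unit_vec i))}.
    have sc : (fun r : R => r *: (unit_vec i : 'rV[R]_d)) @ s --> s *: unit_vec i.
      exact: scalel_continuous.
    exact: cvg_comp sc cD.
  have : \forall r \near s, 'D_(unit_vec i) (pullback f L) (r *: unit_vec i) != 0.
    exact: cvgr_neq0 cl Ds.
  move=> /nbhs_ballP[e /= e0 eP].
  have [y [/= qe [q _ qE]]] :=
    dense_rat (ex_intro _ s (ballxx s e0)) (ball_open s e).
  by have := eP _ qe; rewrite -qE Dq eqxx.
have dl s : is_derive s (1 : R) (fun s => pullback f L (0 + s *: unit_vec i)) 0.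
  by have := is_derive_pullback_line L i s; rewrite add0r D0.
have := is_derive_0_is_cst r 0 dl.
by rewrite /pullback !add0r scale0r act0.
Qed.

Lemma ae_act_eq :
  {ae mu, forall L i, 'D_(unit_vec i) (pullback f L) 0 = 0} ->
  forall t, {ae mu, forall L, f (act t L) = f L}.
Proof.
move=> grad0.
have line i (r : R) : {ae mu, forall L, f (act (r *: unit_vec i) L) = f L}.
  (* The rationals are enumerated by [unpickle], with default value [0]. *)
  have : {ae mu, forall L (n : nat), 'D_(unit_vec i)
      (pullback f (act (ratr (odflt 0 (unpickle n)) *: unit_vec i) L)) 0 = 0}.
    apply: ae_foralln => n.
    have := ae_act (ratr (odflt 0 (unpickle n)) *: unit_vec i) _ grad0.
    by apply: filterS => L; exact.
  apply: filterS => L DL; apply: constant_on_line => q.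
  by have := DL (pickle q); rewrite pickleK derive_pullback_act.
move=> t; rewrite [t]row_sum_delta.
apply: (@big_ind _ (fun t => {ae mu, forall L, f (act t L) = f L})) => //.
- by apply: aeW => L; rewrite act0.
- move=> s u hs hu; have := ae_act u _ hs.
  by apply: filterS2 hu => L; rewrite act_add => <-.
- by move=> j _; exact: line.
Qed.

End invariance.

(** * Dimension one *)

Section one_dimensional.
Context {R : realType} {L0 : delone_set R 1}.
Local Notation Omega := (pattern_space L0).
Variable f : Omega -> R.
Hypothesis hf : harmonic_in setT f.

(** In dimension one the Laplacian is the second derivative. *)
Lemma affine_along_orbit (L : Omega) (r : R) :
  f (act (r *: unit_vec 0) L) = f L + r * (f (act (unit_vec 0) L) - f L).
Proof.
pose e : 'rV[R]_1 := unit_vec 0; pose u := pullback f L.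
pose D := 'D_e u; have [C2 lap0] := harmonic_pullback f L hf.
have dD (s : R) : is_derive s (1 : R) (fun s => D (0 + s *: e)) 0.
  have <- : 'D_e D (0 + s *: e) = 0.
    by have := lap0 (0 + s *: e) I; rewrite /laplacian big_ord1.
  apply: is_derive_line; have [_ /(_ 0)[_ _ /(_ 0)[]]] := C2 (0 + s *: e) I.
  by [].
have Dc s : D (0 + s *: e) = D (0 + 0 *: e) by exact: is_derive_0_is_cst.
set b := D (0 + 0 *: e) in Dc.
pose v s := u (0 + s *: e) - s * b.
have dv (s : R) : is_derive s (1 : R) v 0.
  have h1 := is_derive_pullback_line _ hf L 0 s.
  have h2 : is_derive s (1 : R) (fun s : R => b *: s) (b *: 1).
    exact: is_deriveZ.
  have h3 := is_deriveB h1 h2.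
  have vE : v = (fun s => pullback f L (0 + s *: unit_vec 0)) \- (fun s =>
    b *: s).
    by apply/funext => y; rewrite /v mulrC.
  have D0 : 0 = 'D_(unit_vec 0) (pullback f L) (0 + s *: unit_vec 0) - b *: 1.
    by rewrite [b *: 1]mulr1 -[X in _ - X](Dc s) subrr.
  by rewrite vE D0.
have uE s : u (s *: e) = u 0 + s * b.
  have : v s = v 0 by exact: is_derive_0_is_cst.
  rewrite /v scale0r !add0r mul0r subr0 => <-; lra.
have u0 : u 0 = f L by rewrite /u /pullback act0.
have := uE 1; rewrite scale1r mul1r u0 => u1.
have := uE r; rewrite u0 => ur.
rewrite -/e -[f (act e L)]/(u e) -[LHS]/(u (r *: e)) u1 ur; lra.
Qed.

Lemma ae_act_eq_one_dim (mu : probability Omega R) : uniquely_ergodic mu ->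
  forall t, {ae mu, forall L, f (act t L) = f L}.
Proof.
move=> [mu_inv mu_uniq]; have [mf _] := hf.
pose e : 'rV[R]_1 := unit_vec 0.
pose b L := f (act e L) - f L.
have tE (t : 'rV[R]_1) : t = t 0 0 *: e.
  by apply/rowP => j; rewrite !mxE !ord1 eqxx mulr1.
have mfe : measurable_fun setT (fun L => f (act e L)).
  exact: measurableT_comp mf (measurable_act e).
have b_inv t L : b (act t L) = b L.
  rewrite /b act_add (tE t) -[X in act (X + _) L]scale1r -scalerDl.
  rewrite !affine_along_orbit; rewrite -/(b L); lra.
have mb : measurable_fun setT b by exact: measurable_funB.
have [c bc] : exists c, {ae mu, forall L, b L = c}.
  apply: (invariant_ae_constant mu (fun t => act t)) => //.
  - exact: measurable_act.
  - by move=> t; apply: aeW => L; exact: b_inv.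
have c0 : c = 0.
  apply: (ae_shift_eq0 mu (act e) (measurable_act e) (mu_inv e) f) => //.
  by apply: filterS bc => L <-; rewrite /b addrC subrK.
move=> t; apply: filterS bc => L bL.
by rewrite (tE t) affine_along_orbit -/(b L) bL c0 mulr0 addr0.
Qed.

End one_dimensional.

(** * Integrability and conclusion *)

Section integrable_profiles.
Context {R : realType} {disp : measure_display} {T : measurableType disp}.
Variables (mu : probability T R) (f : T -> R).
Hypothesis mf : measurable_fun setT f.

Lemma measurable_profile s : measurable_fun setT (profile s \o f).
Proof.
apply: measurableT_comp mf.
by apply: continuous_measurable_fun; exact: continuous_profile.
Qed.

Lemma L1_profile1 m : (forall x, m <= f x) -> L1 mu (profile 1 \o f).
Proof.
move=> mfx; apply: L1_le (L1_cst mu (1 + 2 * `|m|)) _;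
  first exact: measurable_profile.
move=> x /=; rewrite ger0_norm ?profile_ge0 ?normr1//.
rewrite (le_trans (profile_le _ _))// mul1r.
have := mfx x; have := ler_norm (- m); rewrite normrN.
by have := normr_ge0 m; case: (ler0P (f x)); lra.
Qed.

Lemma L1_profileN1 m : (forall x, f x <= m) -> L1 mu (profile (-1) \o f).
Proof.
move=> mfx; apply: L1_le (L1_cst mu (1 + 2 * `|m|)) _;
  first exact: measurable_profile.
move=> x /=; rewrite ger0_norm ?profile_ge0 ?normrN1//.
rewrite (le_trans (profile_le _ _))// mulN1r opprK.
have := mfx x; have := ler_norm m.
by have := normr_ge0 m; case: (ler0P (f x)); lra.
Qed.

Lemma L1_profile0 : L1 mu f -> L1 mu (profile 0 \o f).
Proof.
move=> Lf; apply: (L1_le mu _ (fun x => 1 + `|f x|)).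
- exact: measurable_profile.
- by apply: L1D; [exact: L1_cst|exact: L1_norm].
- move=> x /=; rewrite ger0_norm ?profile_ge0 ?normr0//.
  by rewrite (le_trans (profile_le _ _))// mul0r subr0.
Qed.

End integrable_profiles.

Theorem theorem2 (R : realType) (d : nat) (hd : (0 < d)%N)
  (L0 : delone_set R d)
  (hap : aperiodic L0) (hrep : repetitive L0)
  (hflc : finite_local_complexity L0)
  (mu : probability (pattern_space L0) R) (hmu : uniquely_ergodic mu)
  (f : pattern_space L0 -> R) (hf : harmonic_in [set: pattern_space L0] f)
  (hcases : [\/ d = 1%N,
    (-oo < ereal_inf (range (EFin \o f)))%E,
    (ereal_sup (range (EFin \o f)) < +oo)%E |
    mu.-integrable [set: pattern_space L0] (EFin \o f)]) :
  exists c : R, {ae mu, forall L : pattern_space L0, f L = c}.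
Proof.
have [mf _] := hf; have [mu_inv mu_uniq] := hmu.
suff inv : forall t, {ae mu, forall L, f (act t L) = f L}.
  apply: (invariant_ae_constant mu (fun t => act t)) => //.
  exact: measurable_act.
have by_profile s : `|s| <= 1 -> L1 mu (profile s \o f) ->
    forall t, {ae mu, forall L, f (act t L) = f L}.
  by move=> s1 Ls; apply: ae_act_eq => //; exact: ae_gradient_eq0 s1 Ls.
case: hcases => [d1|inf_gt|sup_lt|Lf].
- by subst d; exact: ae_act_eq_one_dim.
- have [m /= inf_m] : exists m : R, (m%:E <= ereal_inf (range (EFin \o f)))%E.
    case: ereal_inf inf_gt => [r _|_|//]; first by exists r.
    by exists 0; rewrite leey.
  apply: (by_profile 1); first by rewrite normr1.
  apply: (@L1_profile1 _ _ _ _ _ mf m) => L; rewrite -lee_fin (le_trans inf_m)//.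
  by apply: ereal_inf_lbound; exists L.
- have [m /= sup_m] : exists m : R, (ereal_sup (range (EFin \o f)) <= m%:E)%E.
    case: ereal_sup sup_lt => [r _|//|_]; first by exists r.
    by exists 0; rewrite leNye.
  apply: (by_profile (-1)); first by rewrite normrN1.
  apply: (@L1_profileN1 _ _ _ _ _ mf m) => L;
    rewrite -lee_fin (le_trans _ sup_m)//.
  by apply: ereal_sup_ubound; exists L.
- by apply: (by_profile 0); [rewrite normr0|exact: L1_profile0].
Qed.
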